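(* Let $\mathcal{D}\subset\mathbb{R}^N$ be open, bounded, connected, and assume $y_0\in\partial\mathcal{D}$ satisfies the exterior cone condition, i.e. there exists a finite cone $C\subset\mathbb{R}^N\setminus\mathcal{D}$ with tip at $y_0$. Then $y_0$ is walk-regular.
   Context: A finite cone with tip at $y_0$ is a set of the form $\{y_0+v: 0<|v|<h,\ \angle(v,e)<\alpha\}$ (together with its tip) for some unit vector $e$, height $h>0$ and aperture $\alpha\in(0,\pi/2)$. Probability space: $\Omega_1=B_1(0)\subset\mathbb{R}^N$ with Borel $\sigma$-algebra and normalised Lebesgue measure; $(\Omega,\mathcal{F},\mathbb{P})$ is the countable product $\Omega=(\Omega_1)^{\mathbb{N}}$, $\omega=\{w_i\}_{i\ge1}$. The $\epsilon$-ball walk started at $x\in\mathcal{D}$: $X_0^{\epsilon,x}\equiv x$, $X_n^{\epsilon,x}=X_{n-1}^{\epsilon,x}+\big(\epsilon\wedge\operatorname{dist}(X_{n-1}^{\epsilon,x},\partial\mathcal{D})\big)w_n$ for $n\ge1$; it converges $\mathbb{P}$-a.s. to a random variable $X^{\epsilon,x}:\Omega\to\partial\mathcal{D}$. A point $y_0\in\partial\mathcal{D}$ is walk-regular if for every $\eta,\delta>0$ there exist $\hat\delta\in(0,\delta)$ and $\hat\epsilon\in(0,1)$ such that $\mathbb{P}(X^{\epsilon,x_0}\in B_\delta(y_0))\ge1-\eta$ for all $\epsilon\in(0,\hat\epsilon)$ and all $x_0\in B_{\hat\delta}(y_0)\cap\mathcal{D}$. *)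

(* Defs.v *)
From HB Require Import structures.
From mathcomp Require Import all_boot all_order all_algebra.
From mathcomp Require Import all_classical all_reals all_analysis.
Set Implicit Arguments.
Unset Strict Implicit.
Unset Printing Implicit Defensive.
Import Order.TTheory GRing.Theory Num.Theory.
Local Open Scope classical_set_scope.
Local Open Scope ring_scope.

Section Defs.
Context {R : realType} {N : nat}.

(* Points of R^N are N-tuples of reals; N.-tuple R carries the product
   (Borel) sigma-algebra of the library. *)
Definition vadd (x y : N.-tuple R) : N.-tuple R :=
  [tuple tnth x i + tnth y i | i < N].
Definition vsub (x y : N.-tuple R) : N.-tuple R :=
  [tuple tnth x i - tnth y i | i < N].
Definition vscale (c : R) (x : N.-tuple R) : N.-tuple R :=
  [tuple c * tnth x i | i < N].
Definition vzero : N.-tuple R := [tuple (0:R) | _ < N].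
Definition vdot (x y : N.-tuple R) : R := \sum_(i < N) tnth x i * tnth y i.
Definition enorm (x : N.-tuple R) : R := Num.sqrt (vdot x x).
Definition eball (y : N.-tuple R) (r : R) : set (N.-tuple R) :=
  [set x | enorm (vsub x y) < r].

Definition eopen (D : set (N.-tuple R)) : Prop :=
  forall x, D x -> exists2 r : R, 0 < r & eball x r `<=` D.
Definition ebounded (D : set (N.-tuple R)) : Prop :=
  exists M : R, forall x, D x -> enorm x <= M.
Definition econnected (D : set (N.-tuple R)) : Prop :=
  forall U V : set (N.-tuple R), eopen U -> eopen V ->
    D `<=` U `|` V -> D `&` U `&` V = set0 ->
    D `&` U !=set0 -> D `&` V !=set0 -> False.
Definition eboundary (D : set (N.-tuple R)) : set (N.-tuple R) :=
  [set y | (forall r : R, 0 < r -> exists x, D x /\ enorm (vsub x y) < r) /\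
           (forall r : R, 0 < r -> exists x, ~ D x /\ enorm (vsub x y) < r)].
Definition edist_bd (D : set (N.-tuple R)) (x : N.-tuple R) : R :=
  inf [set enorm (vsub x y) | y in eboundary D].

Definition eangle (v e : N.-tuple R) : R :=
  acos (vdot v e / (enorm v * enorm e)).

Definition finite_cone (y0 e : N.-tuple R) (h a : R) : set (N.-tuple R) :=
  [set y | y = y0 \/ exists v, y = vadd y0 v /\ 0 < enorm v < h /\
                                eangle v e < a].
Definition is_finite_cone_at (C : set (N.-tuple R)) (y0 : N.-tuple R) : Prop :=
  exists e h a, enorm e = 1 /\ 0 < h /\ 0 < a < pi / 2 /\
                C = finite_cone y0 e h a.

(* Lebesgue measure on R^N, defined as an iterated (Tonelli) integral of the
   indicator: leb_N(A) = int dx_1 ... int dx_N 1_A(x_1,...,x_N). *)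
Fixpoint iter_leb_int (n : nat) : (n.-tuple R -> \bar R) -> \bar R :=
  match n return (n.-tuple R -> \bar R) -> \bar R with
  | 0 => fun f => f [tuple]
  | n'.+1 => fun f =>
      (\int[@lebesgue_measure R]_t iter_leb_int (fun v => f (cons_tuple t v)))%E
  end.
Definition lebN (A : set (N.-tuple R)) : \bar R :=
  iter_leb_int (fun x => (\1_A x)%:E).

(* The epsilon-ball walk driven by the step sequence w (w n is the (n+1)-th
   step w_{n+1} of the paper). *)
Fixpoint ball_walk {T} (D : set (N.-tuple R)) (eps : R) (x : N.-tuple R)
   (w : nat -> T -> N.-tuple R) (om : T) (n : nat) : N.-tuple R :=
  match n with
  | 0 => x
  | n'.+1 => let p := ball_walk D eps x w om n' in
             vadd p (vscale (Num.min eps (edist_bd D p)) (w n' om))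
  end.

Definition econverges (u : nat -> N.-tuple R) (L : N.-tuple R) : Prop :=
  forall e : R, 0 < e -> exists n0, forall n, (n0 <= n)%N -> enorm (vsub (u n) L) < e.

End Defs.

Section Prob.
Context {R : realType} {N : nat} {d : measure_display} {T : measurableType d}.
Local Open Scope ereal_scope.

Definition mutually_independent (P : probability T R)
    (w : nat -> T -> N.-tuple R) : Prop :=
  forall (F : seq nat) (A : nat -> set (N.-tuple R)), uniq F ->
    (forall i, measurable (A i)) ->
    P (\bigcap_(i in [set` F]) (w i @^-1` A i)) = \prod_(i <- F) P (w i @^-1` A i).

(* each w n is uniformly distributed on the unit ball B_1(0):
   P(w n in A) = leb_N(A /\ B_1) / leb_N(B_1), written without division *)
Definition uniform_unit_ball (P : probability T R) (X : T -> N.-tuple R) : Prop :=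
  forall A : set (N.-tuple R), measurable A ->
    P (X @^-1` A) * lebN (eball (@vzero R N) 1) =
    lebN (A `&` eball (@vzero R N) 1).

Definition walk_limit_in (D : set (N.-tuple R)) (eps : R) (x : N.-tuple R)
   (w : nat -> T -> N.-tuple R) (B : set (N.-tuple R)) : set T :=
  [set om | exists L, econverges (ball_walk D eps x w om) L /\ B L].

Definition walk_regular (P : probability T R) (w : nat -> T -> N.-tuple R)
   (D : set (N.-tuple R)) (y0 : N.-tuple R) : Prop :=
  forall eta delta : R, (0 < eta)%R -> (0 < delta)%R ->
  exists dh : R, exists eh : R, (0 < dh < delta)%R /\ (0 < eh < 1)%R /\
    forall (eps : R) (x0 : N.-tuple R), (0 < eps < eh)%R ->
      eball y0 dh x0 -> D x0 ->
      ((1 - eta)%:E <= P (walk_limit_in D eps x0 w (eball y0 delta)))%E.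
End Prob.

(* Main.v *)
(* Let E be the unit vector of the cone axis.  Outside a ball B(z, r) disjoint
   from D, the Gaussian exp(-L |x - z|^2) with L of order r^-2 is submean for
   every symmetric, uniformly non-degenerate step that is short compared with r:
   averaging over w and -w produces a cosh whose gain beats the loss
   exp(-L rho^2).  For z = y0 + r E with small r such balls of radius kappa r
   sit inside the cone, and the corresponding Gaussian takes at y0 the
   value theta > 0, which does not depend on r.  Adding K of them, at scales
   chosen successively much smaller, gives a function that is close to K theta
   near y0, at most K theta + 1 up to a small error everywhere, and small at
   distance delta / 2 from y0.
   Along the walk stopped when it leaves B(y0, delta / 2) its expectation does
   not decrease, so the walk leaves that ball with probability at most eta once
   K is large; no restart at successive scales is needed.  The walk converges
   almost surely by Kolmogorov's maximal inequality, the energies E|X_n|^2 being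
   nondecreasing and bounded. *)
Require Import Defs.
From HB Require Import structures.
From mathcomp Require Import all_boot all_order all_algebra.
From mathcomp Require Import all_classical all_reals all_analysis.
From mathcomp Require Import measurable_realfun.
From mathcomp Require Import ring lra.
Import Order.TTheory GRing.Theory Num.Theory.
Import numFieldNormedType.Exports.
Local Open Scope classical_set_scope.
Local Open Scope ring_scope.
Set Implicit Arguments.
Unset Strict Implicit.
Unset Printing Implicit Defensive.

(** * Euclidean vectors *)

(** The obstacle is uniformity: near the boundary the steps become arbitrarily short, so an estimate
    must hold for every radius rho below a threshold, rho = 0 included. In the Gaussian inequality
    both the gain and the loss are of order rho^2, so rho cancels and only the distance to the
    centre matters. The law of a step enters through three facts: |w| < 1, symmetry, and P(|u.w| >=
    s|u|) >= p for all u with fixed p, s > 0. The first holds only almost surely, so the steps are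
    altered on a null event. With L = mu / r^2 the condition on a ball of radius kappa r reads mu p
    s^2 kappa^2 >= 4, free of r; as y0 is at distance r from the centre, theta = exp(-mu). A single
    Gaussian has maximum 1 but only theta at y0, which bounds the exit probability away from 1 and
    no better. In the sum the excess over the value at y0 stays about 1 while that value is K theta,
    so the exit probability is of order 1 / (K theta). One stopped chain serves twice: frozen
    reference y0 for the exit estimate, reference X_m for the maximal inequality. *)

Section EuclideanSpace.
Context {R : realType} {N : nat}.
Implicit Types (x y z v : N.-tuple R) (c : R).

Lemma tnth_vadd x y i : tnth (vadd x y) i = tnth x i + tnth y i.
Proof. exact: tnth_mktuple. Qed.

Lemma tnth_vsub x y i : tnth (vsub x y) i = tnth x i - tnth y i.
Proof. exact: tnth_mktuple. Qed.

Lemma tnth_vscale c x i : tnth (vscale c x) i = c * tnth x i.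
Proof. exact: tnth_mktuple. Qed.

Definition tnthE := (tnth_vadd, tnth_vsub, tnth_vscale).

Lemma vdotC x y : vdot x y = vdot y x.
Proof. by apply: eq_bigr => i _; rewrite mulrC. Qed.

Lemma vdotDl x y z : vdot (vadd x y) z = vdot x z + vdot y z.
Proof. by rewrite -big_split; apply: eq_bigr => i _ /=; rewrite tnthE mulrDl. Qed.

Lemma vdotBl x y z : vdot (vsub x y) z = vdot x z - vdot y z.
Proof. by rewrite -sumrB; apply: eq_bigr => i _; rewrite tnthE mulrBl. Qed.

Lemma vdotZl c x y : vdot (vscale c x) y = c * vdot x y.
Proof. by rewrite big_distrr; apply: eq_bigr => i _ /=; rewrite tnthE mulrA. Qed.

Lemma vdotDr x y z : vdot z (vadd x y) = vdot z x + vdot z y.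
Proof. by rewrite vdotC vdotDl !(vdotC z). Qed.

Lemma vdotBr x y z : vdot z (vsub x y) = vdot z x - vdot z y.
Proof. by rewrite vdotC vdotBl !(vdotC z). Qed.

Lemma vdotZr c x y : vdot y (vscale c x) = c * vdot y x.
Proof. by rewrite vdotC vdotZl (vdotC y). Qed.

Definition vdotE := (vdotDl, vdotDr, vdotBl, vdotBr, vdotZl, vdotZr).

Lemma vdot_ge0 x : 0 <= vdot x x.
Proof. by apply: sumr_ge0 => i _; rewrite -expr2 sqr_ge0. Qed.

Lemma enorm_ge0 x : 0 <= enorm x.
Proof. exact: sqrtr_ge0. Qed.

Lemma sqr_enorm x : enorm x ^+ 2 = vdot x x.
Proof. by rewrite sqr_sqrtr ?vdot_ge0. Qed.

(** Cauchy-Schwarz: with B = |y|^2 and C = x.y, the vector B x - C y has squared norm B (|x|^2 B -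
    C^2), and B > 0 can be cancelled unless y = 0. *)
Lemma vdot_sqr_le x y : vdot x y ^+ 2 <= vdot x x * vdot y y.
Proof.
have [y0|yn0] := eqVneq (vdot y y) 0.
  suff -> : vdot x y = 0 by rewrite y0 expr0n mulr0.
  apply: big1 => i _; suff -> : tnth y i = 0 by rewrite mulr0.
  have /psumr_eq0P H : forall j, true -> 0 <= tnth y j * tnth y j.
    by move=> j _; rewrite -expr2 sqr_ge0.
  by apply/eqP; rewrite -sqrf_eq0 expr2; apply/eqP; exact: H.
have yp : 0 < vdot y y by rewrite lt_neqAle eq_sym yn0 vdot_ge0.
have := vdot_ge0 (vsub (vscale (vdot y y) x) (vscale (vdot x y) y)).
rewrite !vdotE (vdotC y x).
set A := vdot x x; set B := vdot y y in yp *; set C := vdot x y => h.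
have : 0 <= B * (A * B - C ^+ 2) by apply: le_trans h _; rewrite le_eqVlt; apply/orP; left; apply/eqP; ring.
by rewrite pmulr_rge0// subr_ge0.
Qed.

Lemma vdot_le_enorm x y : `|vdot x y| <= enorm x * enorm y.
Proof.
rewrite -(@ler_pXn2r _ 2)// ?nnegrE ?mulr_ge0 ?enorm_ge0//.
by rewrite real_normK ?num_real// exprMn !sqr_enorm vdot_sqr_le.
Qed.

Lemma enorm_vadd_le x y : enorm (vadd x y) <= enorm x + enorm y.
Proof.
rewrite -(@ler_pXn2r _ 2)// ?nnegrE ?addr_ge0 ?enorm_ge0//.
rewrite sqr_enorm !vdotE sqrrD !sqr_enorm (vdotC y x).
have := le_trans (ler_norm _) (vdot_le_enorm x y).
by rewrite mulr2n; lra.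
Qed.

Lemma enorm_vscale c x : enorm (vscale c x) = `|c| * enorm x.
Proof.
by rewrite /enorm !vdotE mulrA -expr2 sqrtrM ?sqr_ge0// sqrtr_sqr.
Qed.

Lemma enorm_vsubC x y : enorm (vsub x y) = enorm (vsub y x).
Proof. by rewrite /enorm !vdotE (vdotC y x); congr Num.sqrt; ring. Qed.

Lemma enorm_vsub_trans z x y : enorm (vsub x y) <= enorm (vsub x z) + enorm (vsub z y).
Proof.
apply: le_trans (enorm_vadd_le _ _); rewrite le_eqVlt; apply/orP; left.
by apply/eqP; congr enorm; apply: eq_from_tnth => i; rewrite !tnthE; ring.
Qed.

Lemma enorm_vsub_le x y : enorm x <= enorm (vsub x y) + enorm y.
Proof.
apply: le_trans (enorm_vadd_le _ _); rewrite le_eqVlt; apply/orP; left.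
by apply/eqP; congr enorm; apply: eq_from_tnth => i; rewrite !tnthE; ring.
Qed.

Lemma enorm_vsubxx x : enorm (vsub x x) = 0.
Proof. by rewrite /enorm !vdotE !subrr sqrtr0. Qed.

Lemma vadd_vscale0 x v : vadd x (vscale 0 v) = x.
Proof. by apply: eq_from_tnth => i; rewrite !tnthE mul0r addr0. Qed.

Lemma vadd_vsub x y : vsub (vadd x y) x = y.
Proof. by apply: eq_from_tnth => i; rewrite !tnthE; ring. Qed.

Lemma normr_tnth_le_enorm x i : `|tnth x i| <= enorm x.
Proof.
rewrite -(@ler_pXn2r _ 2)// ?nnegrE ?enorm_ge0//.
rewrite real_normK ?num_real// sqr_enorm /vdot (bigD1 i)//= -expr2 lerDl.
by apply: sumr_ge0 => j _; rewrite -expr2 sqr_ge0.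
Qed.

Lemma enorm_le_sum x : enorm x <= \sum_(i < N) `|tnth x i|.
Proof.
rewrite -(@ler_pXn2r _ 2)// ?nnegrE ?enorm_ge0// ?sumr_ge0//.
rewrite sqr_enorm expr2 big_distrl/=; apply: ler_sum => i _.
rewrite -expr2 -real_normK ?num_real// expr2 ler_wpM2l//.
by rewrite (bigD1 i)//= lerDl sumr_ge0.
Qed.

Definition vopp x : N.-tuple R := vscale (-1) x.

Lemma vadd_vscale_vopp c x y :
  vadd x (vscale c (vopp y)) = vadd x (vscale (- c) y).
Proof. by apply: eq_from_tnth => i; rewrite !tnthE; ring. Qed.

Lemma vsub_vadd x y z : vsub (vadd x y) z = vadd (vsub x z) y.
Proof. by apply: eq_from_tnth => i; rewrite !tnthE; ring. Qed.

End EuclideanSpace.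

(** * Measurability of vector operations, level sets and balls *)

Section MeasurableVectors.
Context {R : realType} {N : nat} {d : measure_display} {S : measurableType d}.
Implicit Types f g : S -> N.-tuple R.

Lemma measurable_tnth_comp f i : measurable_fun setT f ->
  measurable_fun setT (fun s => tnth (f s) i).
Proof. by move=> /measurable_fun_tnthP; apply. Qed.

Lemma measurable_vadd f g : measurable_fun setT f -> measurable_fun setT g ->
  measurable_fun setT (fun s => vadd (f s) (g s)).
Proof.
move=> mf mg; apply/measurable_fun_tnthP => i.
rewrite (_ : _ \o _ = fun s => tnth (f s) i + tnth (g s) i); last first.
  by apply/funext => s /=; rewrite tnthE.
by apply: measurable_funD; exact: measurable_tnth_comp.
Qed.

Lemma measurable_vsub f g : measurable_fun setT f -> measurable_fun setT g ->
  measurable_fun setT (fun s => vsub (f s) (g s)).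
Proof.
move=> mf mg; apply/measurable_fun_tnthP => i.
rewrite (_ : _ \o _ = fun s => tnth (f s) i - tnth (g s) i); last first.
  by apply/funext => s /=; rewrite tnthE.
by apply: measurable_funB; exact: measurable_tnth_comp.
Qed.

Lemma measurable_vscale (c : S -> R) g :
  measurable_fun setT c -> measurable_fun setT g ->
  measurable_fun setT (fun s => vscale (c s) (g s)).
Proof.
move=> mf mg; apply/measurable_fun_tnthP => i.
rewrite (_ : _ \o _ = fun s => c s * tnth (g s) i); last first.
  by apply/funext => s /=; rewrite tnthE.
by apply: measurable_funM => //; exact: measurable_tnth_comp.
Qed.

Lemma measurable_vdot f g : measurable_fun setT f -> measurable_fun setT g ->
  measurable_fun setT (fun s => vdot (f s) (g s)).
Proof.
move=> mf mg; apply: measurable_sum => i.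
by apply: measurable_funM; exact: measurable_tnth_comp.
Qed.

Lemma measurable_enorm f : measurable_fun setT f ->
  measurable_fun setT (fun s => enorm (f s)).
Proof.
move=> mf; apply: (measurableT_comp (f := @Num.sqrt R)).
  by apply: continuous_measurable_fun; exact: sqrt_continuous.
exact: measurable_vdot.
Qed.

End MeasurableVectors.

Section LevelSets.
Context {R : realType} {d : measure_display} {T : measurableType d}.
Variables (f : T -> R) (c : R).
Hypothesis mf : measurable_fun setT f.

Lemma measurable_superlevel : measurable [set t | c <= f t].
Proof.
rewrite (_ : [set _ | _] = f @^-1` `[c, +oo[%classic).
  by rewrite -[X in measurable X]setTI; apply: mf => //; exact: measurable_itv.
by apply/seteqP; split => t /=; rewrite in_itv/= andbT.
Qed.

Lemma measurable_sublevel : measurable [set t | f t <= c].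
Proof.
rewrite (_ : [set _ | _] = f @^-1` `]-oo, c]%classic).
  by rewrite -[X in measurable X]setTI; apply: mf => //; exact: measurable_itv.
by apply/seteqP; split => t /=; rewrite in_itv.
Qed.

Lemma measurable_strict_sublevel : measurable [set t | f t < c].
Proof.
rewrite (_ : [set _ | _] = f @^-1` `]-oo, c[%classic).
  by rewrite -[X in measurable X]setTI; apply: mf => //; exact: measurable_itv.
by apply/seteqP; split => t /=; rewrite in_itv.
Qed.

End LevelSets.

Lemma measurable_vdot_sqr_ge {R : realType} {N : nat} (u : N.-tuple R) (c : R) :
  measurable [set v | c <= vdot u v ^+ 2].
Proof.
by apply: measurable_superlevel; apply: measurable_funX; exact: measurable_vdot.
Qed.

Lemma measurable_eball {R : realType} {N : nat} (y : N.-tuple R) (r : R) :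
  measurable (eball y r).
Proof.
by apply: measurable_strict_sublevel; apply: measurable_enorm; exact: measurable_vsub.
Qed.

(** * Reflection invariance of Lebesgue measure on the line *)

Section LebesgueReflection.
Context {R : realType}.
Local Open Scope ereal_scope.
Let mu := @lebesgue_measure R.

Let mopp : measurable_fun [set: measurableTypeR R]
  (-%R : measurableTypeR R -> measurableTypeR R).
Proof. exact: oppr_measurable. Qed.

(** The pushforward under negation gives ]a, b] the measure of [-b, -a[, which is b - a; a measure
    with these values on half-open intervals is Lebesgue measure. *)
Lemma lebesgue_measure_oppr (A : set R) : measurable A ->
  mu (-%R @^-1` A) = mu A.
Proof.
pose nu : {measure set (measurableTypeR R) -> \bar R} :=
  measure_function_pushforward__canonical__measure_function_Measure mu mopp.
move=> mA; rewrite -[LHS]/(nu A); apply/esym/lebesgue_measure_unique => // X.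
move=> /ocitvP[->|[[a b]/= ab ->]].
  by rewrite !measure0.
rewrite /nu/= /pushforward (_ : _ @^-1` _ = `[(- b)%R, (- a)%R[%classic); last first.
  by apply/seteqP; split => x /=; rewrite !in_itv/=; lra.
by rewrite !lebesgue_measure_itv/= !lte_fin ltrN2 ab -!EFinB; congr EFin; ring.
Qed.

Lemma ge0_integral_oppr (f : R -> \bar R) : measurable_fun setT f ->
  (forall x, 0 <= f x) -> \int[mu]_x f (- x)%R = \int[mu]_x f x.
Proof.
move=> mf f0.
rewrite -[LHS](ge0_integral_pushforward mopp mu (D := setT))//.
by apply: eq_measure_integral => A mA _; exact: lebesgue_measure_oppr.
Qed.

End LebesgueReflection.

(** * Lebesgue measure as an iterated integral *)

Section IteratedLebesgueIntegral.
Context {R : realType}.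
Local Open Scope ereal_scope.
Let mu := @lebesgue_measure R.

Lemma integral_indic_itv (a b : R) : (a <= b)%R ->
  \int[mu]_t (\1_`[a, b] t)%:E = (b - a)%:E.
Proof.
move=> ab; rewrite integral_indic// setIT.
apply: (etrans (lebesgue_measure_itv `[a, b])); rewrite /= lte_fin.
by case: ltgtP ab => // -> _; rewrite subrr.
Qed.

Lemma iter_leb_int_ge0 n (f : n.-tuple R -> \bar R) :
  (forall v, 0 <= f v) -> 0 <= iter_leb_int f.
Proof. by elim: n f => [|n IH] f f0 //=; apply: integral_ge0 => t _; exact: IH. Qed.

(** The parameter space is arbitrary so that the induction closes: the first coordinate joins the
    parameters, the induction hypothesis is used on S x R, and Tonelli integrates that coordinate
    out. *)
Lemma measurable_iter_leb_int n d (S : measurableType d)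
    (f : S -> n.-tuple R -> \bar R) :
  measurable_fun setT (fun p => f p.1 p.2) -> (forall s v, 0 <= f s v) ->
  measurable_fun setT (fun s => iter_leb_int (f s)).
Proof.
elim: n d S f => [|n IH] d S f mf f0 /=.
  exact: (measurableT_comp (f := fun p => f p.1 p.2) mf (g := fun s => (s, [tuple]))).
apply: (@measurable_fun_fubini_tonelli_F _ _ S (measurableTypeR R) R mu
  (fun p => iter_leb_int (fun v => f p.1 (cons_tuple p.2 v)))) => [|p].
  apply: (IH _ (S * measurableTypeR R)%type
    (fun p v => f p.1 (cons_tuple p.2 v))) => //.
  apply: (measurableT_comp (f := fun p => f p.1 p.2) mf
    (g := fun p : (S * measurableTypeR R) * n.-tuple R =>
      (p.1.1, cons_tuple p.1.2 p.2))).
  apply: measurable_fun_pair => /=.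
    exact: (measurableT_comp (f := fst) _ measurable_fst).
  apply: measurable_cons => //.
  exact: (measurableT_comp (f := snd) _ measurable_fst).
exact: iter_leb_int_ge0.
Qed.

Lemma measurable_iter_leb_int_cons n (f : n.+1.-tuple R -> \bar R) :
  measurable_fun setT f -> (forall v, 0 <= f v) ->
  measurable_fun setT (fun t : R => iter_leb_int (fun v => f (cons_tuple t v))).
Proof.
move=> mf f0; apply: (measurable_iter_leb_int (S := measurableTypeR R)) => //.
apply: (measurableT_comp (f := f) mf) => /=.
exact: measurable_cons.
Qed.

Lemma measurable_cons_tuple n (t : R) (f : n.+1.-tuple R -> \bar R) :
  measurable_fun setT f -> measurable_fun setT (fun v => f (cons_tuple t v)).
Proof.
by move=> mf; apply: (measurableT_comp (f := f) mf); exact: measurable_cons.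
Qed.

Lemma iter_leb_int0 n : iter_leb_int (fun _ : n.-tuple R => 0 : \bar R) = 0.
Proof. by elim: n => //= n IH; apply: integral0_eq. Qed.

Lemma iter_leb_int_vopp n (f : n.-tuple R -> \bar R) :
  measurable_fun setT f -> (forall v, 0 <= f v) ->
  iter_leb_int (fun v => f (vopp v)) = iter_leb_int f.
Proof.
elim: n f => [|n IH] f mf f0 /=; first by rewrite (tuple0 (vopp _)).
rewrite -[RHS](ge0_integral_oppr (measurable_iter_leb_int_cons mf f0)); last first.
  by move=> t; exact: iter_leb_int_ge0.
apply: eq_integral => t _.
rewrite -(IH (fun v => f (cons_tuple (- t)%R v)))//; last exact: measurable_cons_tuple.
congr iter_leb_int; apply/funext => v; congr f.
apply: eq_from_tnth => i; rewrite tnthE.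
case: (unliftP ord0 i) => [j ->|->]; last by rewrite !tnth0 mulN1r.
by rewrite !tnthS tnthE.
Qed.

(** This and the next lemma compare volumes with cubes. The volume of the unit ball is never
    computed; only its positivity and the upper bound 2^N matter. *)
Lemma iter_leb_int_box_le n (f : n.-tuple R -> \bar R) (a : R) : (0 <= a)%R ->
  measurable_fun setT f -> (forall v, 0 <= f v <= 1) ->
  (forall v i, (a < `|tnth v i|)%R -> f v = 0) ->
  iter_leb_int f <= ((a *+ 2) ^+ n)%:E.
Proof.
move=> a0; elim: n f => [|n IH] f mf f01 fa /=.
  by have /andP[] := f01 [tuple].
have f0 v : 0 <= f v by have /andP[] := f01 v.
have a2 : (0 <= a *+ 2)%R by rewrite mulrn_wge0.
apply: (@le_trans _ _ (\int[mu]_t (((a *+ 2) ^+ n)%:E * (\1_`[(- a)%R, a] t)%:E))).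
  apply: ge0_le_integral => //.
  - by move=> t _; exact: iter_leb_int_ge0.
  - exact: measurable_iter_leb_int_cons.
  - by apply: measurable_funeM; apply/measurable_EFinP; exact: measurable_indic.
  move=> t _; rewrite indicE.
  case: (boolP (t \in _)) => [_|].
    rewrite mule1; apply: IH => // [|v i ai]; first exact: measurable_cons_tuple.
    by apply: (fa _ (lift ord0 i)); rewrite tnthS.
  rewrite notin_setE/= in_itv/= => tN.
  rewrite mule0 (_ : (fun v => _) = (fun=> 0)) ?iter_leb_int0//.
  apply/funext => v; apply: (fa _ ord0); rewrite tnth0 ltNge ler_norml.
  exact/negP.
rewrite ge0_integralZl//; last by rewrite lee_fin exprn_ge0.
  rewrite integral_indic_itv; last by rewrite lerNl (le_trans _ a0)// oppr_le0.
  by rewrite -EFinM opprK -mulr2n exprSr.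
by apply/measurable_EFinP; exact: measurable_indic.
Qed.

Lemma iter_leb_int_box_ge n (f : n.-tuple R -> \bar R) (a : n.-tuple R) (s : R) :
  (0 <= s)%R -> measurable_fun setT f -> (forall v, 0 <= f v) ->
  (forall v, (forall i, tnth a i <= tnth v i <= tnth a i + s)%R -> 1 <= f v) ->
  (s ^+ n)%:E <= iter_leb_int f.
Proof.
move=> s0; elim: n f a => [|n IH] f a mf f0 fa /=.
  by apply: fa => -[].
pose a0 := tnth a ord0.
apply: (@le_trans _ _ (\int[mu]_t ((s ^+ n)%:E * (\1_`[a0, (a0 + s)%R] t)%:E))).
  rewrite ge0_integralZl//; last by rewrite lee_fin exprn_ge0.
    by rewrite integral_indic_itv ?lerDl// (addrC a0) addrK -EFinM exprSr.
  by apply/measurable_EFinP; exact: measurable_indic.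
apply: ge0_le_integral => //.
- by move=> t _; rewrite mule_ge0// lee_fin ?exprn_ge0.
- by apply: measurable_funeM; apply/measurable_EFinP; exact: measurable_indic.
- exact: measurable_iter_leb_int_cons.
move=> t _; rewrite indicE.
case: (boolP (t \in _)) => [|_]; last by rewrite mule0 iter_leb_int_ge0.
rewrite inE/= in_itv/= mule1 => ta.
apply: (IH _ [tuple of behead a]) => // [|v av]; first exact: measurable_cons_tuple.
apply: fa => i; case: (unliftP ord0 i) => [j ->|->]; last by rewrite tnth0.
move: (av j); rewrite tnthS !(tnth_behead, tnthS) (_ : inord j.+1 = lift ord0 j)//.
by apply/val_inj; rewrite /= inordK// ltnS.
Qed.

End IteratedLebesgueIntegral.

(** * The uniform law on the unit ball: support, symmetry and spread *)

Section UniformStep.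
Context {R : realType} {N : nat} {d : measure_display} {T : measurableType d}.
Variables (P : probability T R) (X : T -> N.-tuple R).
Hypothesis mX : measurable_fun setT X.
Hypothesis X_unif : uniform_unit_ball P X.
Local Open Scope ereal_scope.

Let B := eball (@vzero R N) 1.

Lemma vsubx0 (x : N.-tuple R) : vsub x (@vzero R N) = x.
Proof. by apply: eq_from_tnth => i; rewrite tnthE tnth_mktuple subr0. Qed.

Lemma unit_ballE (x : N.-tuple R) : eball (@vzero R N) 1 x = (enorm x < 1)%R :> Prop.
Proof. by rewrite /eball/= vsubx0. Qed.

Lemma enorm_vopp (x : N.-tuple R) : enorm (vopp x) = enorm x.
Proof. by rewrite enorm_vscale normrN1 mul1r. Qed.

Lemma measurable_vopp : measurable_fun setT (@vopp R N).
Proof. exact: measurable_vscale. Qed.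

Let measurable_indicE (A : set (N.-tuple R)) : measurable A ->
  measurable_fun setT (fun x => (\1_A x)%:E : \bar R).
Proof. by move=> mA; apply/measurable_EFinP; exact: measurable_indic. Qed.

Lemma lebN_unit_ball_le : lebN B <= (2 ^+ N)%:E.
Proof.
apply: (@iter_leb_int_box_le _ _ _ 1%R) => //.
- by apply: measurable_indicE; exact: measurable_eball.
- by move=> v; rewrite !lee_fin indicE; case: (_ \in _); rewrite ?lexx ?ler01.
move=> v i vi; rewrite indicE memNset//; rewrite /B unit_ballE; apply/negP; rewrite -leNgt.
exact: le_trans (ltW vi) (normr_tnth_le_enorm _ _).
Qed.

Lemma lebN_ge_box (A : set (N.-tuple R)) (a : N.-tuple R) (s : R) : (0 <= s)%R ->
  measurable A ->
  (forall v, (forall i, tnth a i <= tnth v i <= tnth a i + s)%R -> A v) ->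
  (s ^+ N)%:E <= lebN A.
Proof.
move=> s0 mA aA; apply: (iter_leb_int_box_ge (a := a)) => //.
  exact: measurable_indicE.
by move=> v av; rewrite indicE mem_set//; exact: aA.
Qed.

(** Small enough that coordinates of size at most twice this value have absolute sum N / (2 (N + 1))
    < 1, which keeps the box inside the unit ball. The successor avoids a division by zero when N =
    0. *)
Definition box_side : R := (4 * N.+1%:R)^-1.

Lemma box_side_gt0 : (0 < box_side)%R.
Proof. by rewrite invr_gt0 mulr_gt0. Qed.

Lemma enorm_box_lt1 (v : N.-tuple R) :
  (forall i, `|tnth v i| <= 2 * box_side)%R -> (enorm v < 1)%R.
Proof.
move=> vs; apply: (le_lt_trans (enorm_le_sum v)).
apply: (@le_lt_trans _ _ (\sum_(i < N) 2 * box_side)%R); first by apply: ler_sum => i _.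
rewrite sumr_const card_ord -(mulr_natr _ N) /box_side mulrAC ltr_pdivrMr ?mulr_gt0//.
by rewrite mul1r -natr1; have := ler0n R N; lra.
Qed.

(** Lower corner of a box lying in the orthant of u: each coordinate ranges over [s, 2s] or
    [-2s, -s] according to the sign of u_i, so that every product u_i v_i is at least s |u_i| and
    nothing cancels in u.v. *)
Definition orthant_corner (u : N.-tuple R) : N.-tuple R :=
  [tuple if (0 <= tnth u i)%R then box_side else (- (2 * box_side))%R | i < N].

Lemma orthant_boxP (u v : N.-tuple R) :
  (forall i, tnth (orthant_corner u) i <= tnth v i <=
             tnth (orthant_corner u) i + box_side)%R ->
  (enorm v < 1)%R /\ (box_side * enorm u <= vdot u v)%R.
Proof.
have s0 := box_side_gt0.
move=> uv; split.
  apply: enorm_box_lt1 => i; have := uv i; rewrite tnth_mktuple ler_norml.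
  by case: ifP => _; lra.
apply: (@le_trans _ _ (box_side * \sum_(i < N) `|tnth u i|)%R).
  by rewrite ler_pM2l//; exact: enorm_le_sum.
rewrite big_distrr/=; apply: ler_sum => i _; have := uv i; rewrite tnth_mktuple.
case: ifPn => [u0|]; first by rewrite ger0_norm//; nra.
by rewrite -ltNge => u0; rewrite ltr0_norm//; nra.
Qed.

Lemma lebN_unit_ball_gt0 : 0 < lebN B.
Proof.
apply: lt_le_trans (lebN_ge_box (a := orthant_corner (@vzero R N))
  (ltW box_side_gt0) (measurable_eball _ _) _).
  by rewrite lte_fin exprn_gt0// box_side_gt0.
by move=> v /orthant_boxP[v1 _]; rewrite unit_ballE.
Qed.

Lemma lebN_unit_ball_fin : lebN B \is a fin_num.
Proof.
rewrite ge0_fin_numE; last exact: ltW lebN_unit_ball_gt0.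
by rewrite (le_lt_trans lebN_unit_ball_le)// ltry.
Qed.

Lemma uniform_unit_ball_inside : P (X @^-1` ~` B) = 0.
Proof.
have := X_unif (measurableC (measurable_eball (@vzero R N) 1)).
rewrite setICl [RHS](_ : _ = 0); last first.
  rewrite /lebN (_ : (fun _ => _) = fun=> 0) ?iter_leb_int0//.
  by apply/funext => x; rewrite indic0.
move/eqP; rewrite mule_eq0 => /orP[/eqP//|/eqP L0].
by move: lebN_unit_ball_gt0; rewrite /B L0 ltxx.
Qed.

(** The unit ball and [lebN] are invariant under v -> -v, so both probabilities agree after
    multiplication by the volume of the ball, which is positive and finite and hence cancels. *)
Lemma uniform_unit_ball_sym (A : set (N.-tuple R)) : measurable A ->
  P (X @^-1` (@vopp R N @^-1` A)) = P (X @^-1` A).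
Proof.
move=> mA.
have mNA : measurable (@vopp R N @^-1` A).
  by rewrite -[Z in measurable Z]setTI; exact: measurable_vopp.
have : P (X @^-1` (@vopp R N @^-1` A)) * lebN B = P (X @^-1` A) * lebN B.
  rewrite !X_unif// /lebN -[RHS]iter_leb_int_vopp.
  - congr iter_leb_int; apply/funext => v; rewrite !indicE; congr ((_ : bool)%:R%:E).
    by apply/idP/idP; rewrite !inE => -[/= Av]; rewrite ?unit_ballE ?enorm_vopp//;
      split => //; rewrite unit_ballE ?enorm_vopp.
  - by apply: measurable_indicE; apply: measurableI => //; exact: measurable_eball.
  - by move=> v; rewrite lee_fin.
move/(congr1 (fun z => z * (fine (lebN B))^-1%:E)).
have L0 : (fine (lebN B) != 0)%R.
  by rewrite fine_eq0 ?lebN_unit_ball_fin// gt_eqF// lebN_unit_ball_gt0.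
rewrite -!muleA -(fineK lebN_unit_ball_fin) -EFinM mulfV//.
by rewrite !mule1.
Qed.

(** Non-degeneracy, uniform in the direction u: the orthant box has volume s^N and the ball at most
    2^N. Intersecting with the ball lets the bound survive the truncation of the steps. *)
Lemma uniform_unit_ball_spread (u : N.-tuple R) :
  ((box_side / 2) ^+ N)%:E <=
  P (X @^-1` ([set v | ((box_side * enorm u) ^+ 2 <= vdot u v ^+ 2)%R] `&` B)).
Proof.
have mA := measurable_vdot_sqr_ge u ((box_side * enorm u) ^+ 2)%R.
have mAB := measurableI _ _ mA (measurable_eball (@vzero R N) 1).
set E := X @^-1` _.
have mE : measurable E by rewrite -[Z in measurable Z]setTI; exact: mX.
have : (box_side ^+ N)%:E <= P E * (2 ^+ N)%:E.
  apply: (@le_trans _ _ (P E * lebN B)); last first.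
    by apply: lee_wpmul2l; [exact: measure_ge0|exact: lebN_unit_ball_le].
  rewrite X_unif//.
  apply: (lebN_ge_box (a := orthant_corner u)); first exact/ltW/box_side_gt0.
    by apply: measurableI => //; exact: measurable_eball.
  move=> v /orthant_boxP[v1 uv]; split; last by rewrite unit_ballE.
  split; last by rewrite /B unit_ballE.
  by rewrite /= ler_pXn2r// nnegrE ?(le_trans _ uv)// mulr_ge0 ?enorm_ge0// ltW// box_side_gt0.
rewrite -(fineK (fin_num_measure P E mE)) -EFinM !lee_fin expr_div_n.
by rewrite ler_pdivrMr// exprn_gt0.
Qed.

End UniformStep.

(** * Independence and Markov chains *)

Section Independence.
Context {R : realType} {d : measure_display} {T : measurableType d}
  {d1 : measure_display} {S : measurableType d1}
  {d2 : measure_display} {E : measurableType d2}.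
Variable P : probability T R.
Local Open Scope ereal_scope.

Lemma measurable_preimage (X : T -> S) (A : set S) :
  measurable_fun setT X -> measurable A -> measurable (X @^-1` A).
Proof. by move=> mX mA; rewrite -[Z in measurable Z]setTI; exact: mX. Qed.

Lemma integral_prob_cst (c : R) : \int[P]_t c%:E = c%:E.
Proof.
rewrite -[LHS]/(\int[P]_t cst c%:E t) integral_cst// -[RHS]mule1.
by congr (_ * _); exact: probability_setT.
Qed.

(** The joint law agrees with the product of the marginals on rectangles, hence everywhere, and
    Tonelli separates the two variables. *)
Lemma ge0_integral_indep (X : T -> S) (Y : T -> E) (phi : S * E -> \bar R) :
  measurable_fun setT X -> measurable_fun setT Y ->
  (forall A B, measurable A -> measurable B ->
    P (X @^-1` A `&` Y @^-1` B) = P (X @^-1` A) * P (Y @^-1` B)) ->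
  measurable_fun setT phi -> (forall z, 0 <= phi z) ->
  \int[P]_t phi (X t, Y t) = \int[P]_t \int[P]_t' phi (X t, Y t').
Proof.
move=> mX mY XY mphi phi0.
pose X' : {mfun T >-> S} := HB.pack X (isMeasurableFun.Build _ _ _ _ _ mX).
pose Y' : {mfun T >-> E} := HB.pack Y (isMeasurableFun.Build _ _ _ _ _ mY).
have mXY : measurable_fun setT (fun t => (X t, Y t)) by exact: measurable_fun_pair.
pose Z : {mfun T >-> (S * E)%type} :=
  HB.pack (fun t => (X t, Y t)) (isMeasurableFun.Build _ _ _ _ _ mXY).
rewrite -[LHS](ge0_integral_pushforward mXY P (D := setT))//.
transitivity (\int[distribution P X' \x distribution P Y']_z phi z).
  apply: eq_measure_integral => A mA _.
  exact/esym/(@product_measure_unique _ _ _ _ _ (distribution P X')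
    (distribution P Y') (distribution P Z) XY A mA).
rewrite fubini_tonelli1//.
rewrite (ge0_integral_pushforward mX)//; last 2 first.
  exact: measurable_fun_fubini_tonelli_F.
  by move=> y _; exact: integral_ge0.
apply: eq_integral => t _ /=.
rewrite /fubini_F (ge0_integral_pushforward mY)//.
by apply: measurableT_comp => //; exact: measurable_pair1.
Qed.

End Independence.

(** * Chains driven by independent steps *)

Section MarkovChain.
Context {R : realType} {N : nat} {d : measure_display} {T : measurableType d}
  {d1 : measure_display} {S : measurableType d1}.
Variables (P : probability T R) (W : nat -> T -> N.-tuple R).
Hypothesis W_meas : forall n, measurable_fun setT (W n).
Hypothesis W_indep : mutually_independent P W.
Variables (F : nat -> S * N.-tuple R -> S) (s0 : S).
Hypothesis F_meas : forall n, measurable_fun setT (F n).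
Local Open Scope ereal_scope.

Fixpoint chain (n : nat) (om : T) : S :=
  if n is n'.+1 then F n' (chain n' om, W n' om) else s0.

Lemma measurable_chain n : measurable_fun setT (chain n).
Proof.
elim: n => [|n IH] /=; first exact: measurable_cst.
by apply: measurableT_comp => //; exact: measurable_fun_pair.
Qed.

Let cyl (s : seq nat) (B : nat -> set (N.-tuple R)) :=
  \bigcap_(i in [set` s]) (W i @^-1` B i).

Let measurable_cyl s B : (forall i, measurable (B i)) -> measurable (cyl s B).
Proof.
move=> mB; apply: fin_bigcap_measurable; first exact: finite_seq.
by move=> i _; exact: measurable_preimage.
Qed.

Let cyl_cons n s B : cyl (n :: s) B = W n @^-1` B n `&` cyl s B.
Proof.
rewrite /cyl; apply/seteqP; split => t.
  by move=> h; split => [|i si]; apply: h; rewrite /= inE ?eqxx// (si : i \in s) orbT.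
by move=> [h1 h2] i /=; rewrite inE => /orP[/eqP ->//|]; exact: h2.
Qed.

Let cyl_nil B : cyl [::] B = setT.
Proof. by apply/seteqP; split => // t _ i. Qed.

(** Independence is assumed for finite families of steps only. The state at time n + 1 depends on
    the state at n and on W n, so the induction must carry whole cylinders of present and future
    steps, not just one step. *)
Lemma chain_indep_cylinder n (A : set S) (s : seq nat) (B : nat -> set (N.-tuple R)) :
  measurable A -> uniq s -> all (leq n) s -> (forall i, measurable (B i)) ->
  P (chain n @^-1` A `&` \bigcap_(i in [set` s]) (W i @^-1` B i)) =
  P (chain n @^-1` A) * P (\bigcap_(i in [set` s]) (W i @^-1` B i)).
Proof.
elim: n A s B => [|n IH] A s B mA us ns mB; rewrite -/(cyl s B).
  have [As0|As0] := pselect (A s0).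
    rewrite (_ : chain 0 @^-1` A = setT) ?setTI ?probability_setT ?mul1e//.
    by apply/seteqP; split.
  by rewrite (_ : chain 0 @^-1` A = set0) ?set0I ?measure0 ?mul0e//; apply/seteqP; split.
have mZ : measurable_fun setT (fun t => (chain n t, W n t)).
  by apply: measurable_fun_pair => //; exact: measurable_chain.
have mC := measurable_cyl s mB.
(* Both are measures in the event C for the pair (state, step): m1 restricts to the future cylinder,
   m2 multiplies by its probability. Agreement on rectangles is enough. *)
pose m1 : {measure set (S * N.-tuple R) -> \bar R} :=
  measure_function_pushforward__canonical__measure_function_Measure (mrestr P mC) mZ.
have pC : (0 <= fine (P (cyl s B)))%R by exact/fine_ge0/measure_ge0.
pose m2 : {measure set (S * N.-tuple R) -> \bar R} :=
  mscale (NngNum pC)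
   (measure_function_pushforward__canonical__measure_function_Measure P mZ).
have PC : (fine (P (cyl s B)))%:E = P (cyl s B) by rewrite fineK// fin_num_measure.
suff : forall C, measurable C -> m1 C = m2 C.
  move=> /(_ (F n @^-1` A) (measurable_preimage (F_meas n) mA)).
  rewrite /m1 /m2/= /mrestr /pushforward /mscale/= PC muleC; exact.
move=> C mC'.
apply: (measure_unique [set A `*` B | A in measurable & B in measurable] (fun=> setT)) => //.
- exact: measurable_prod_measurableType.
- move=> _ _ [A1 mA1 [B1 mB1 <-]] [A2 mA2 [B2 mB2 <-]].
  exists (A1 `&` A2); first exact: measurableI.
  exists (B1 `&` B2); first exact: measurableI.
  by rewrite setXI.
- by move=> _; exists setT => //; exists setT => //; rewrite setXTT.
- by rewrite bigcup_const.
- move=> _ [A1 mA1 [B1 mB1 <-]].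
  rewrite /m1 /m2/= /mrestr /pushforward /mscale/= PC.
  (* The condition on W n from the rectangle is absorbed into the cylinder; n does not occur in s,
     whose entries are at least n + 1, so the old conditions are unchanged. *)
  pose B' i := if i == n then B1 else B i.
  have mB' i : measurable (B' i) by rewrite /B'; case: ifP.
  have nins : n \notin s by apply/negP => /(allP ns); rewrite ltnn.
  have cylB' : cyl s B' = cyl s B.
    apply: eq_bigcapr => i /= si; rewrite /B'.
    by case: eqP si nins => // -> ->.
  have sn : all (leq n) (n :: s) by rewrite /= leqnn/=; apply: sub_all ns => i /ltnW.
  have usn : uniq (n :: s) by rewrite /= nins.
  have := IH A1 (n :: s) B' mA1 usn sn mB'.
  have := IH A1 [:: n] B' mA1 isT _ mB'; rewrite /= leqnn => /(_ isT).
  have := W_indep usn mB'; have := W_indep us mB'.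
  rewrite -!/(cyl _ _) !cyl_cons cylB' big_cons.
  rewrite !cyl_nil !setIT.
  have -> : B' n = B1 by rewrite /B' eqxx.
  move=> <- -> H1 H2.
  have mem_rect : (fun t => (chain n t, W n t)) @^-1` (A1 `*` B1) =
    chain n @^-1` A1 `&` W n @^-1` B1 by [].
  by rewrite /pushforward mem_rect -setIA H2 H1 muleA muleC.
by move=> _; rewrite /m1/= /pushforward/= /mrestr preimage_setT setTI ltey_eq fin_num_measure.
Qed.

Lemma chain_indep n (A : set S) (B : set (N.-tuple R)) :
  measurable A -> measurable B ->
  P (chain n @^-1` A `&` W n @^-1` B) = P (chain n @^-1` A) * P (W n @^-1` B).
Proof.
move=> mA mB.
have := @chain_indep_cylinder n A [:: n] (fun=> B) mA isT.
by rewrite /= leqnn -/(cyl _ _) cyl_cons cyl_nil setIT; exact.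
Qed.

Lemma integral_chain_next n (f : S -> R) : measurable_fun setT f -> (forall s, 0 <= f s)%R ->
  \int[P]_t (f (chain n.+1 t))%:E =
  \int[P]_t \int[P]_t' (f (F n (chain n t, W n t')))%:E.
Proof.
move=> mf f0.
apply: (ge0_integral_indep (phi := fun z => (f (F n z))%:E)) => //.
- exact: measurable_chain.
- exact: chain_indep.
- by apply/measurable_EFinP; exact: measurableT_comp.
- by move=> z; rewrite lee_fin.
Qed.

(** Submartingale monotonicity without conditional expectations: by independence the next step can
    be averaged with the state frozen. The one-step inequality is asked only at states the chain
    attains, so invariants such as membership in D may be used to prove it. *)
Lemma le_integral_chain m n (f : S -> R) :
  measurable_fun setT f -> (forall s, 0 <= f s)%R ->
  (forall k t, (m <= k)%N ->
    (f (chain k t))%:E <= \int[P]_t' (f (F k (chain k t, W k t')))%:E) ->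
  (m <= n)%N ->
  \int[P]_t (f (chain m t))%:E <= \int[P]_t (f (chain n t))%:E.
Proof.
move=> mf f0 sub; elim: n => [|n IH]; first by rewrite leqn0 => /eqP ->.
rewrite leq_eqVlt => /orP[/eqP ->//|]; rewrite ltnS => mn.
apply: (le_trans (IH mn)); rewrite integral_chain_next//.
apply: ge0_le_integral => //.
- by move=> t _; rewrite lee_fin.
- by apply/measurable_EFinP; apply: measurableT_comp => //; exact: measurable_chain.
- pose g (z : S * T) := (f (F n (z.1, W n z.2)))%:E.
  have mg : measurable_fun setT g.
    apply/measurable_EFinP; apply: measurableT_comp => //; apply: measurableT_comp => //.
    by apply: measurable_fun_pair => //; exact: (measurableT_comp (W_meas n)).
  have mh : measurable_fun setT (fubini_F P g).
    by apply: measurable_fun_fubini_tonelli_F => // z; rewrite /g lee_fin.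
  by apply: (measurableT_comp mh); exact: measurable_chain.
by move=> t _; exact: sub.
Qed.

End MarkovChain.

(** * Distance to the boundary and the exterior cone *)

Section LipschitzMeasurable.
Context {R : realType} {N : nat}.

Definition rat_point (q : N.-tuple rat) : N.-tuple R := [tuple ratr (tnth q i) | i < N].

Lemma rat_point_dense (x : N.-tuple R) (e : R) : 0 < e ->
  exists q, enorm (vsub x (rat_point q)) < e.
Proof.
move=> e0; pose e' := e / N.+1%:R.
have e'0 : 0 < e' by rewrite divr_gt0.
have /choice[q hq] : forall i : 'I_N, exists q : rat, ratr q \in `]tnth x i, tnth x i + e'[.
  move=> i; have /rat_in_itvoo[q qi] : tnth x i < tnth x i + e' by rewrite ltrDl.
  by exists q.
exists [tuple q i | i < N]; apply: le_lt_trans (enorm_le_sum _) _.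
apply: (@le_lt_trans _ _ (\sum_(i < N) e')).
  apply: ler_sum => i _; rewrite !(tnthE, tnth_mktuple); have := hq i.
  by rewrite in_itv/= => /andP[h1 h2]; rewrite ler_norml; apply/andP; split; lra.
rewrite sumr_const card_ord -(mulr_natr _ N) /e' mulrAC ltr_pdivrMr//.
by rewrite ltr_pM2l// ltr_nat.
Qed.

(** The set f < c is the union over rational q of the balls of centre q and radius c - f(q), a ball
    of nonpositive radius being empty. *)
Lemma lipschitz_measurable (f : N.-tuple R -> R) :
  (forall x y, f x <= f y + enorm (vsub x y)) -> measurable_fun setT f.
Proof.
move=> fL mD; apply: (measurability _ (RGenInftyO.measurableE R)) => //.
move=> _ [_ [c ->] <-]; rewrite setTI.
have -> : f @^-1` `]-oo, c[%classic =
    \bigcup_(q in [set: N.-tuple rat]) eball (rat_point q) (c - f (rat_point q)).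
  apply/seteqP; split => [x /=|x [q _]].
    rewrite in_itv/= => fc.
    have /(rat_point_dense x)[q hq] : 0 < (c - f x) / 2 by rewrite divr_gt0// subr_gt0.
    exists q => //; rewrite /eball/=.
    by have := fL (rat_point q) x; rewrite enorm_vsubC; lra.
  by rewrite /eball/= in_itv/= => h; have := fL x (rat_point q); lra.
apply: countable_bigcupT_measurable => [|q]; first exact: countableP.
exact: measurable_eball.
Qed.

End LipschitzMeasurable.

Section BoundaryDistance.
Context {R : realType} {N : nat}.
Variables (D : set (N.-tuple R)) (y0 : N.-tuple R).
Hypothesis y0_bd : eboundary D y0.

Let bd_lbound x : has_lbound [set enorm (vsub x y) | y in eboundary D].
Proof. by exists 0 => _ [y _ <-]; exact: enorm_ge0. Qed.

Lemma edist_bd_le x y : eboundary D y -> edist_bd D x <= enorm (vsub x y).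
Proof. by move=> Dy; apply: (ge_inf (bd_lbound x)); exists y. Qed.

(** The boundary point y0 makes the set of distances nonempty, so [inf] is a genuine infimum here
    and in the Lipschitz bound. *)
Lemma edist_bd_ge0 x : 0 <= edist_bd D x.
Proof.
apply: lb_le_inf; first by exists (enorm (vsub x y0)); exists y0.
by move=> _ [y _ <-]; exact: enorm_ge0.
Qed.

Lemma edist_bd_lipschitz x z : edist_bd D x <= edist_bd D z + enorm (vsub x z).
Proof.
rewrite -lerBlDr; apply: lb_le_inf; first by exists (enorm (vsub z y0)); exists y0.
move=> _ [y Dy <-]; rewrite lerBlDr addrC.
exact: le_trans (edist_bd_le _ Dy) (enorm_vsub_trans _ _ _).
Qed.

Lemma measurable_edist_bd : measurable_fun setT (edist_bd D).
Proof. by apply: lipschitz_measurable; exact: edist_bd_lipschitz. Qed.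

(** The boundary point is at the supremum of the times up to which the whole initial piece of the
    segment stays in D. If a neighbourhood of it lay in D, that time could be increased or would
    already be 1, putting the endpoint in D. *)
Lemma segment_meets_boundary x v : D x -> ~ D (vadd x v) ->
  exists2 t, 0 <= t <= 1 & eboundary D (vadd x (vscale t v)).
Proof.
move=> Dx Dxv; pose pt t := vadd x (vscale t v).
have pt_dist s t : enorm (vsub (pt s) (pt t)) = `|s - t| * enorm v.
  by rewrite -enorm_vscale; congr enorm; apply: eq_from_tnth => i; rewrite !tnthE; ring.
have pt1 : pt 1 = vadd x v by apply: eq_from_tnth => i; rewrite !tnthE mul1r.
pose A := [set t : R | 0 <= t <= 1 /\ forall s, 0 <= s <= t -> D (pt s)].
have A0 : A 0.
  split; first by rewrite lexx ler01.
  move=> s /le_anti <-; rewrite /pt (_ : vadd _ _ = x)//.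
  by apply: eq_from_tnth => i; rewrite !tnthE mul0r addr0.
have ubA : has_ubound A by exists 1 => t [/andP[]].
have supA : has_sup A by split => //; exists 0.
have t0 : 0 <= sup A by exact: ub_le_sup.
have t1 : sup A <= 1 by apply: ge_sup; [exists 0|move=> t [/andP[]]].
exists (sup A); first by rewrite t0.
have v0 := enorm_ge0 v.
have v1 : 0 < enorm v + 1 by lra.
(* The denominator |v| + 1 rather than |v| also covers v = 0. *)
have small r s : 0 < r -> `|s| <= r / (enorm v + 1) -> `|s| * enorm v < r.
  move=> r0 sr; apply: (@le_lt_trans _ _ (r / (enorm v + 1) * enorm v)).
    by rewrite ler_wpM2r.
  by rewrite mulrAC ltr_pdivrMr// ltr_pM2l//; lra.
split => r r0.
  have /sup_adherent/(_ supA)[t At rt] : 0 < r / (enorm v + 1).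
    exact: divr_gt0.
  exists (pt t); split; first by case: At => /andP[t0' _]; apply; rewrite t0' lexx.
  rewrite pt_dist small// distrC ger0_norm; first by lra.
  by rewrite subr_ge0; apply: ub_le_sup.
apply: contrapT => noout.
have inD t : `|t - sup A| <= r / (enorm v + 1) -> D (pt t).
  move=> tr; apply: contrapT => Dt; apply: noout; exists (pt t); split => //.
  by rewrite pt_dist small.
(* A time past the supremum, capped at 1. Being in A it cannot exceed [sup A], so the cap is
   attained and the endpoint lies in D. *)
pose s := Num.min 1 (sup A + r / (enorm v + 1)).
have rv0 : 0 < r / (enorm v + 1) by rewrite divr_gt0.
have As : A s.
  split; first by rewrite ge_min lexx le_min ler01/=; lra.
  move=> u /andP[u0]; rewrite le_min => /andP[u1 us].
  have [uA|uA] := ltP u (sup A).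
    have /sup_adherent/(_ supA)[t [_ tD] ut] : 0 < sup A - u by lra.
    by apply: tD; rewrite u0/=; lra.
  by apply: inD; rewrite ger0_norm; lra.
have : s <= sup A by exact: ub_le_sup.
rewrite ge_min => /orP[A1|]; last by lra.
apply: Dxv; rewrite -pt1; case: As => _; apply.
by rewrite ler01 le_min lexx/=; lra.
Qed.

(** An escaping step would cross the boundary within distance rho |w| < rho, contradicting rho <=
    dist(x, boundary). This keeps the walk in D; rho = 0 is separate because the strict inequality
    then fails. *)
Lemma ball_step_in x w rho : D x -> enorm w < 1 -> 0 <= rho <= edist_bd D x ->
  D (vadd x (vscale rho w)).
Proof.
move=> Dx w1 /andP[]; rewrite le_eqVlt => /orP[/eqP <-|rho0] rhod.
  by rewrite vadd_vscale0.
apply: contrapT => /(segment_meets_boundary Dx)[t /andP[t0 t1]] /(edist_bd_le x).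
rewrite leNgt => /negP; apply.
rewrite (_ : enorm _ = t * (rho * enorm w)); last first.
  rewrite enorm_vsubC vadd_vsub !enorm_vscale !ger0_norm//; exact: ltW.
apply: lt_le_trans rhod; apply: (@le_lt_trans _ _ (rho * enorm w)).
  by rewrite ler_piMl// mulr_ge0 ?enorm_ge0// ltW.
by rewrite gtr_pMr.
Qed.

End BoundaryDistance.

(** * Balls inside the exterior cone *)

Section ExteriorCone.
Context {R : realType} {N : nat}.

Lemma finite_cone_contains_balls (y0 e : N.-tuple R) (h a : R) :
  enorm e = 1 -> 0 < h -> 0 < a < pi / 2 ->
  exists kappa r0 : R, [/\ 0 < kappa < 1, 0 < r0 &
    forall r, 0 < r < r0 ->
      eball (vadd y0 (vscale r e)) (kappa * r) `<=` finite_cone y0 e h a].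
Proof.
move=> e1 h0 /andP[a0 api]; pose c := cos a.
have pi0 : 0 < pi :> R by exact: pi_gt0.
have c0 : 0 < c by apply: cos_gt0_pihalf; apply/andP; split; lra.
have c1 : c < 1.
  by rewrite -cos0 ltr_cos// in_itv/=; apply/andP; split; lra.
(* With |v - r e| < k r one has v.e > r (1 - k) and |v| < r (1 + k), so the cosine exceeds (1 - k) /
   (1 + k). For k = (1 - c) / 4 this exceeds c, since 1 - k - c (1 + k) = (1 - c)(3 - c) / 4. Also
   |v| < 5r/4 < h. *)
exists ((1 - c) / 4), (h / 2); split; [by apply/andP; split; lra|lra|].
set k := (1 - c) / 4 => r /andP[r0 rh] x.
rewrite /eball/= => xb; right; exists (vsub x y0).
pose v := vsub x y0.
have vre : enorm (vsub v (vscale r e)) < k * r.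
  rewrite (_ : vsub v _ = vsub x (vadd y0 (vscale r e)))//.
  by apply: eq_from_tnth => i; rewrite !tnthE; ring.
have re : enorm (vscale r e) = r by rewrite enorm_vscale e1 mulr1 gtr0_norm.
have v_le := enorm_vsub_le v (vscale r e).
have v_ge := enorm_vsub_le (vscale r e) v; rewrite enorm_vsubC in v_ge.
have k0 : 0 < k by rewrite /k; lra.
have k1 : k * r <= r / 4 by rewrite /k; nra.
have v0 : 0 < enorm v by lra.
split; first by apply: eq_from_tnth => i; rewrite !tnthE; ring.
split; first by rewrite v0; lra.
have ve_ge : r - k * r <= vdot v e.
  have -> : vdot v e = r + vdot (vsub v (vscale r e)) e.
    by rewrite vdotBl vdotZl -sqr_enorm e1; ring.
  have := vdot_le_enorm (vsub v (vscale r e)) e; rewrite e1 mulr1 ler_norml.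
  by lra.
have ve_le := vdot_le_enorm v e; rewrite e1 mulr1 in ve_le.
rewrite /eangle e1 mulr1.
set q := vdot v e / enorm v.
have q01 : -1 <= q <= 1.
  by rewrite -ler_norml normrM normfV (gtr0_norm v0) ler_pdivrMr// mul1r.
have cq : c < q.
  rewrite ltr_pdivlMr//; rewrite /k in ve_ge vre v_le k0; nra.
(* [cos] decreases strictly on [0, pi], so an angle of at least a would force q <= cos a, against
   [cq]. *)
rewrite -/v ltNge; apply/negP => aq.
have : q <= c.
  rewrite -(acosK (x := q)) ?in_itv//= /c leNgt ltr_cos ?in_itv/=.
  - by rewrite -leNgt.
  - by rewrite (acos_ge0 q01) acos_lepi.
  - by apply/andP; split; lra.
by rewrite leNgt cq.
Qed.

End ExteriorCone.

(** * Gaussian barriers *)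

(** With b = exp(t/2) the left side of the sum is b^2 + b^-2 = 2 + (b - 1/b)^2, and b - 1/b >= t/2
    for t >= 0 because b >= 1 + t/2 and 1/b <= 1. *)
Lemma expR_addN_ge {R : realType} (t : R) : 2 + t ^+ 2 / 4 <= expR t + expR (- t).
Proof.
wlog t0 : t / 0 <= t.
  move=> H; have [/H//|/ltW t0] := leP 0 t.
  by have := H (- t); rewrite sqrrN opprK addrC (addrC (expR _)); apply; lra.
pose u := t / 2; have u0 : 0 <= u by rewrite /u; lra.
have -> : t = u + u by rewrite /u; lra.
rewrite opprD !expRD expRN; have e1 := expR_ge1Dx u.
set a := expR u in e1 *; have a0 : 0 < a by exact: expR_gt0.
have ai1 : a^-1 <= 1 by rewrite invf_le1//; lra.
have aV : a * a^-1 = 1 by rewrite mulfV// gt_eqF.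
have ai0 : 0 < a^-1 by rewrite invr_gt0.
have : u ^+ 2 <= (a - a^-1) ^+ 2 by rewrite ler_pXn2r ?nnegrE//; lra.
nra.
Qed.

(** From exp(-t) >= 1 - t and (1 - t)(1 + 2t) = 1 + t (1 - 2t). This is how a relative gain 2t pays
    for the damping exp(-t). *)
Lemma expRN_mul_ge1 {R : realType} (t : R) : 0 <= t <= 2^-1 -> 1 <= expR (- t) * (1 + 2 * t).
Proof. by move=> /andP[t0 t1]; have := expR_ge1Dx (- t); nra. Qed.

Section SymmetricSteps.
Context {R : realType} {N : nat} {d : measure_display} {T : measurableType d}.
Variables (P : probability T R) (W : T -> N.-tuple R).
Hypothesis W_meas : measurable_fun setT W.
Hypothesis W_lt1 : forall t, enorm (W t) < 1.
Hypothesis W_sym : forall A : set (N.-tuple R), measurable A ->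
  P (W @^-1` (@vopp R N @^-1` A)) = P (W @^-1` A).
Local Open Scope ereal_scope.

Lemma integral_vopp (h : N.-tuple R -> \bar R) : measurable_fun setT h ->
  (forall v, 0 <= h v) -> \int[P]_t h (vopp (W t)) = \int[P]_t h (W t).
Proof.
move=> mh h0.
have mNW : measurable_fun setT (@vopp R N \o W).
  by apply: measurableT_comp => //; exact: measurable_vopp.
rewrite -[LHS](ge0_integral_pushforward mNW P (D := setT))//.
rewrite -[RHS](ge0_integral_pushforward W_meas P (D := setT))//.
by apply: eq_measure_integral => A mA _; exact: W_sym.
Qed.

(** By symmetry twice the integral of h(W) is that of h(W) + h(-W). Pairing v with -v cancels the
    terms odd in v and leaves a pointwise inequality on the unit ball. *)
Lemma le_integral_symmetrized (k h : N.-tuple R -> R) :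
  measurable_fun setT k -> measurable_fun setT h ->
  (forall v, 0 <= k v)%R -> (forall v, 0 <= h v)%R ->
  (forall v, (enorm v < 1 -> k v + k v <= h v + h (vopp v))%R) ->
  \int[P]_t (k (W t))%:E <= \int[P]_t (h (W t))%:E.
Proof.
move=> mk mh k0 h0 kh.
have mkW : measurable_fun setT (fun t => (k (W t))%:E).
  by apply/measurable_EFinP; exact: measurableT_comp.
have mhW : measurable_fun setT (fun t => (h (W t))%:E).
  by apply/measurable_EFinP; exact: measurableT_comp.
have mhNW : measurable_fun setT (fun t => (h (vopp (W t)))%:E).
  apply/measurable_EFinP; apply: measurableT_comp => //.
  by apply: measurableT_comp => //; exact: measurable_vopp.
rewrite -(@lee_pmul2l _ 2%:E)// !mule_natl !mule2n.
rewrite -[X in _ <= _ + X](integral_vopp (h := EFin \o h)) => [|//|v]; last 2 first.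
- exact/measurable_EFinP.
- by rewrite /= lee_fin.
rewrite -!ge0_integralD//; last 4 first.
- by move=> t _; rewrite lee_fin.
- by move=> t _; rewrite /= lee_fin.
- by move=> t _; rewrite lee_fin.
- by move=> t _; rewrite lee_fin.
apply: ge0_le_integral => //.
- by move=> t _; rewrite adde_ge0// lee_fin.
- exact: emeasurable_funD.
- exact: emeasurable_funD.
by move=> t _; rewrite /= -!EFinD lee_fin kh.
Qed.

Lemma le_integral_midpoint (c : R) (h : N.-tuple R -> R) :
  measurable_fun setT h -> (0 <= c)%R -> (forall v, 0 <= h v)%R ->
  (forall v, (enorm v < 1 -> c + c <= h v + h (vopp v))%R) ->
  c%:E <= \int[P]_t (h (W t))%:E.
Proof.
move=> mh c0 h0 ch.
rewrite -[leLHS](integral_prob_cst P).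
exact: (le_integral_symmetrized (k := cst c)).
Qed.

Definition gauss (z : N.-tuple R) (L : R) (x : N.-tuple R) : R :=
  expR (- (L * enorm (vsub x z) ^+ 2)).

Lemma measurable_gauss z L : measurable_fun setT (gauss z L).
Proof.
apply: measurableT_comp => //; apply: measurable_funN; apply: measurable_funM => //.
by apply: measurable_funX; apply: measurable_enorm; exact: measurable_vsub.
Qed.

Lemma measurable_step (x : N.-tuple R) (rho : R) :
  measurable_fun setT (fun v : N.-tuple R => vadd x (vscale rho v)).
Proof. by apply: measurable_vadd => //; exact: measurable_vscale. Qed.

Variables (p s : R).
Hypothesis p_ge0 : (0 <= p)%R.
Hypothesis W_spread : forall u, p%:E <=
  P (W @^-1` [set v | ((s * enorm u) ^+ 2 <= vdot u v ^+ 2)%R]).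

(** With y = x - z, moving by rho v multiplies the Gaussian by exp(-L rho^2 |v|^2) exp(-2 L rho
    y.v). Averaging over v and -v turns the last factor into a cosh, at least 1 + b when |y.v| >=
    s|y|, an event of probability at least p. The hypothesis on r gives b p >= 2 L rho^2, which
    outweighs exp(-L rho^2). *)
Lemma gauss_step (z x : N.-tuple R) (L r rho : R) :
  (0 < L)%R -> (0 <= r <= enorm (vsub x z))%R -> (4 <= L * p * s ^+ 2 * r ^+ 2)%R ->
  (0 <= L * rho ^+ 2 <= 2^-1)%R ->
  (gauss z L x)%:E <= \int[P]_t (gauss z L (vadd x (vscale rho (W t))))%:E.
Proof.
move=> L0 /andP[r0 rx] Lr Lrho.
set y := vsub x z in rx *.
pose A := [set v : N.-tuple R | ((s * enorm y) ^+ 2 <= vdot y v ^+ 2)%R].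
have mA : measurable A by exact: measurable_vdot_sqr_ge.
have i0 v : (0 <= \1_A v :> R)%R by rewrite indicE ler0n.
(* c is the value at x with the worst damping |v| = 1; b is half of t^2 / 4 for t = 2 L rho y.v, at
   the smallest |y.v| allowed on A. *)
pose c := (gauss z L x * expR (- (L * rho ^+ 2)))%R.
pose b := (L ^+ 2 * rho ^+ 2 * (s * enorm y) ^+ 2 / 2)%R.
have c0 : (0 <= c)%R by rewrite mulr_ge0// expR_ge0.
have b0 : (0 <= b)%R by rewrite /b divr_ge0// -!exprMn sqr_ge0.
apply: (@le_trans _ _ (\int[P]_t (c + c * b * \1_A (W t))%:E)).
  rewrite -[leRHS]/(\int[P]_t (cst c%:E t + (c * b)%:E * (\1_A (W t))%:E)).
  have mWA : measurable (W @^-1` A) by exact: measurable_preimage.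
  have m1 : measurable_fun setT (fun t => (\1_A (W t))%:E : \bar R).
    by apply/measurable_EFinP; apply: measurableT_comp => //; exact: measurable_indic.
  rewrite ge0_integralD//; last 2 first.
  - move=> t _; apply: mule_ge0; [by rewrite lee_fin mulr_ge0|by rewrite lee_fin i0].
  - exact: measurable_funeM.
  have -> : \int[P]_t cst c%:E t = c%:E by exact: integral_prob_cst.
  rewrite ge0_integralZl//; last first.
    by rewrite lee_fin mulr_ge0.
  rewrite [X in _ * X](_ : _ = P (W @^-1` A)); last first.
    transitivity (\int[P]_t (\1_(W @^-1` A) t)%:E); first by [].
    by rewrite integral_indic// setIT.
  apply: (@le_trans _ _ (c%:E + (c * b)%:E * p%:E)); last first.
    rewrite leeD2l// lee_wpmul2l//; [by rewrite lee_fin mulr_ge0|exact: W_spread].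
  rewrite -EFinM -EFinD lee_fin /c -[leLHS]mulr1.
  set G := gauss z L x; have G0 : (0 < G)%R by exact: expR_gt0.
  rewrite -!mulrA -mulrDr ler_pM2l// -[X in (X + _)%R]mulr1 -mulrDr.
  apply: (le_trans (expRN_mul_ge1 Lrho)); rewrite ler_pM2l ?expR_gt0// lerD2l.
  have /andP[h0 _] := Lrho.
  have rr : (r ^+ 2 <= enorm y ^+ 2)%R by rewrite ler_pXn2r ?nnegrE// (le_trans r0).
  have : (L * p * s ^+ 2 * r ^+ 2 <= L * p * s ^+ 2 * enorm y ^+ 2)%R.
    by rewrite ler_wpM2l// mulr_ge0 ?sqr_ge0// mulr_ge0// ltW.
  move=> h; rewrite /b.
  (* b p is regrouped as L rho^2 times L p s^2 |y|^2 / 2; the second factor is at least 2 since |y|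
     >= r. *)
  rewrite [leRHS](_ : _ = (L * rho ^+ 2) * (L * p * s ^+ 2 * enorm y ^+ 2) / 2)%R; last by field.
  have : (L * rho ^+ 2 * 4 <= (L * rho ^+ 2) * (L * p * s ^+ 2 * enorm y ^+ 2))%R.
    by rewrite ler_wpM2l//; exact: le_trans h.
  lra.
apply: (le_integral_symmetrized (k := (fun v => c + c * b * \1_A v)%R)
   (h := (fun v => gauss z L (vadd x (vscale rho v)))%R)).
- by apply: measurable_funD => //; apply: measurable_funM => //; exact: measurable_indic.
- by apply: measurableT_comp; [exact: measurable_gauss|exact: measurable_step].
- by move=> v; rewrite addr_ge0// mulr_ge0 ?i0// mulr_ge0.
- by move=> v; exact: expR_ge0.
move=> v v1; set q := vdot y v.
have gE v' : gauss z L (vadd x (vscale rho v')) =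
    (gauss z L x * expR (- (L * rho ^+ 2 * enorm v' ^+ 2)) *
     expR (- (2 * L * rho * vdot y v')))%R.
  rewrite /gauss -!expRD vsub_vadd -/y; congr expR.
  by rewrite !sqr_enorm !(vdotDl, vdotDr, vdotZl, vdotZr) (vdotC v' y); ring.
rewrite !gE enorm_vopp vdotZr -/q -mulrDr.
set t := (2 * L * rho * q)%R.
have -> : (- (2 * L * rho * (-1 * q)) = t)%R by rewrite /t; ring.
have ht := expR_addN_ge t.
have e1 : (expR (- (L * rho ^+ 2)) <= expR (- (L * rho ^+ 2 * enorm v ^+ 2)))%R.
  rewrite ler_expR lerN2 ler_piMr//; first by case/andP: Lrho.
  by rewrite expr_le1// ?enorm_ge0// ltW.
have cc : (c <= gauss z L x * expR (- (L * rho ^+ 2 * enorm v ^+ 2)))%R.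
  by rewrite ler_wpM2l// expR_ge0.
have tb : (2 + 2 * b * \1_A v <= 2 + t ^+ 2 / 4)%R.
  rewrite lerD2l indicE; case: (boolP (v \in A)) => [|_]; last first.
    by rewrite mulr0 divr_ge0// sqr_ge0.
  rewrite inE /A/= -/q => sq; rewrite mulr1 /b /t.
  have := ler_wpM2l (mulr_ge0 (sqr_ge0 L) (sqr_ge0 rho)) sq.
  by rewrite !exprMn; lra.
apply: (@le_trans _ _ (c * (2 + 2 * b * \1_A v))%R).
  by rewrite le_eqVlt; apply/orP; left; apply/eqP; ring.
apply: ler_pM => //; first by rewrite addr_ge0// mulr_ge0 ?i0// mulr_ge0.
rewrite (addrC (expR _)); exact: le_trans ht.
Qed.

End SymmetricSteps.

(** * The sum of Gaussians at separated scales *)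

Section Barrier.
Context {R : realType} {N : nat} {d : measure_display} {T : measurableType d}.
Variables (P : probability T R) (W : nat -> T -> N.-tuple R).
Hypothesis W_meas : forall n, measurable_fun setT (W n).
Hypothesis W_lt1 : forall n t, enorm (W n t) < 1.
Hypothesis W_sym : forall n (A : set (N.-tuple R)), measurable A ->
  P (W n @^-1` (@vopp R N @^-1` A)) = P (W n @^-1` A).
Variables (p s : R).
Hypotheses (p_gt0 : 0 < p) (s_gt0 : 0 < s).
Hypothesis W_spread : forall n u, (p%:E <=
  P (W n @^-1` [set v | ((s * enorm u) ^+ 2 <= vdot u v ^+ 2)%R]))%E.
Variables (D : set (N.-tuple R)) (y0 e : N.-tuple R) (kappa r0 : R).
Hypotheses (e1 : enorm e = 1) (kappa_gt0 : 0 < kappa) (r0_gt0 : 0 < r0).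
Hypothesis D_avoids_cone : forall r x, 0 < r < r0 -> D x ->
  kappa * r <= enorm (vsub x (vadd y0 (vscale r e))).

Definition submean (G : N.-tuple R -> R) (n : nat) (x : N.-tuple R) (rho : R) : Prop :=
  ((G x)%:E <= \int[P]_t (G (vadd x (vscale rho (W n t))))%:E)%E.

(** Chosen so that L = mu / r^2 satisfies L p s^2 (kappa r)^2 = 4 exactly, the requirement of
    [gauss_step] outside the ball of radius kappa r. *)
Let mu := 4 / (p * s ^+ 2 * kappa ^+ 2).
Let theta := expR (- mu).

Let mu_gt0 : 0 < mu.
Proof. by rewrite divr_gt0// !mulr_gt0// exprn_gt0. Qed.

Let scaled (r : R) := gauss (vadd y0 (vscale r e)) (mu / r ^+ 2).

Let center_dist r : 0 < r -> enorm (vsub y0 (vadd y0 (vscale r e))) = r.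
Proof.
by move=> r_gt0; rewrite enorm_vsubC vadd_vsub enorm_vscale e1 mulr1 gtr0_norm.
Qed.

Let scaled_ge0 r x : 0 <= scaled r x. Proof. exact: expR_ge0. Qed.

Let scaled_le1 r x : 0 < r -> scaled r x <= 1.
Proof.
move=> r_gt0; rewrite -expR0 ler_expR oppr_le0.
by rewrite mulr_ge0 ?sqr_ge0// divr_ge0 ?sqr_ge0// ltW.
Qed.

(** What is needed is L rho^2 <= 1/2. As rho <= 1 gives rho^2 <= rho, a bound linear in rho suffices
    and no square root enters the threshold. *)
Let scaled_submean r n x rho : 0 < r < r0 -> D x -> 0 <= rho <= 1 ->
  rho <= r ^+ 2 / (2 * mu) -> submean (scaled r) n x rho.
Proof.
move=> rr Dx /andP[rho0 rho1] rhor; have /andP[r_gt0 _] := rr.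
have r2 : 0 < r ^+ 2 by rewrite exprn_gt0.
apply: (gauss_step (W_meas n) (W_lt1 n) (W_sym n) (ltW p_gt0) (W_spread n) (r := kappa * r)).
- by rewrite divr_gt0.
- by rewrite mulr_ge0 ?(ltW kappa_gt0) ?(ltW r_gt0)//=; exact: D_avoids_cone.
- rewrite le_eqVlt; apply/orP; left; apply/eqP; rewrite /mu; field.
  by rewrite !gt_eqF.
- have L0 : 0 < mu / r ^+ 2 by rewrite divr_gt0.
  rewrite (mulr_ge0 (ltW L0) (sqr_ge0 _))/=.
  rewrite mulrAC ler_pdivrMr// mulrC -ler_pdivlMr//.
  have : rho ^+ 2 <= rho by rewrite expr2 ler_piMl.
  move=> /le_trans; apply; apply: (le_trans rhor).
  by rewrite le_eqVlt; apply/orP; left; apply/eqP; field; rewrite gt_eqF.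
Qed.

Let scaled_far e' t0 : 0 < e' -> 0 < t0 -> exists2 r, 0 < r < r0 &
  forall x, t0 <= enorm (vsub x y0) -> scaled r x <= e'.
Proof.
move=> e'0 t0_gt0.
(* With r <= t0 / 2 the centre is at distance at least t0 / 2 from x, so the exponent u is at least
   mu t0^2 / (4 r^2). Then r <= 1 and r <= m give r^2 <= m, hence u >= 1 / e', and exp(-u) <= 1 /
   u. *)
pose m := mu * t0 ^+ 2 * e' / 4.
have m0 : 0 < m by rewrite /m divr_gt0// mulr_gt0// mulr_gt0// exprn_gt0.
pose r := Num.min (Num.min (r0 / 2) (t0 / 2)) (Num.min 1 m).
have r_gt0 : 0 < r by rewrite !lt_min ltr01 m0 !divr_gt0.
have /andP[/andP[ra rb] /andP[rc rd]] :
    ((r <= r0 / 2) && (r <= t0 / 2)) && ((r <= 1) && (r <= m)).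
  by rewrite -!le_min lexx.
exists r; first by rewrite r_gt0/=; lra.
move=> x tx; rewrite /scaled /gauss; set z := vadd y0 _.
have := enorm_vsub_trans z x y0; rewrite (enorm_vsubC z) center_dist// => xz.
have xz2 : t0 / 2 <= enorm (vsub x z) by lra.
set q := enorm (vsub x z) in xz2 *.
have q2 : (t0 / 2) ^+ 2 <= q ^+ 2 by rewrite ler_pXn2r ?nnegrE//; lra.
have rm : r ^+ 2 <= m by apply: le_trans rd; rewrite expr2 ler_piMl// ltW.
have r2 : 0 < r ^+ 2 by rewrite exprn_gt0.
pose u := mu / r ^+ 2 * q ^+ 2.
have ue : 1 <= u * e'.
  have : mu * (t0 / 2) ^+ 2 * e' <= mu * q ^+ 2 * e'.
    by rewrite ler_wpM2r ?(ltW e'0)// ler_wpM2l// ltW.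
  move=> h; rewrite /u (_ : _ * _ = mu * q ^+ 2 * e' / r ^+ 2); last first.
    by field; rewrite gt_eqF.
  rewrite ler_pdivlMr// mul1r (le_trans rm)// (le_trans _ h)//.
  by rewrite /m le_eqVlt; apply/orP; left; apply/eqP; field.
rewrite -/u expRN -[e']invrK lef_pV2 ?posrE ?invr_gt0 ?expR_gt0//.
apply: (@le_trans _ _ u); first by rewrite -[e'^-1]mul1r ler_pdivrMr.
by apply: le_trans (expR_ge1Dx u); lra.
Qed.

Let scaled_near r tau : 0 < r -> 0 < tau -> exists2 t, 0 < t &
  forall x, enorm (vsub x y0) < t -> `|scaled r x - theta| <= tau.
Proof.
move=> r_gt0 tau0.
have /cvgrPdist_le/(_ tau tau0) := @continuous_expR R (- mu).
rewrite near_nbhs => /nbhs_ballP[dl /= dl0 hd].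
(* For t = |x - y0| < r and q = |x - z|, |q^2 - r^2| <= t * 3r, so the exponent differs from mu by
   at most 3 t mu / r, below dl for this choice. *)
exists (Num.min r (dl * r / (4 * mu))).
  by rewrite lt_min r_gt0/= divr_gt0// mulr_gt0.
move=> x; rewrite lt_min => /andP[xr xd]; rewrite distrC; apply: hd.
set z := vadd y0 (vscale r e).
rewrite /ball/= opprK addrC.
have xz1 := enorm_vsub_trans y0 x z; have xz2 := enorm_vsub_trans x y0 z.
rewrite center_dist// in xz1 xz2; rewrite (enorm_vsubC y0 x) in xz2.
have := enorm_ge0 (vsub x y0).
set q := enorm (vsub x z) in xz1 xz2 *; set t := enorm (vsub x y0) in xz1 xz2 xr xd * => t0.
have -> : mu / r ^+ 2 * q ^+ 2 - mu = mu / r ^+ 2 * ((q - r) * (q + r)).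
  by field; rewrite gt_eqF.
have r2 : 0 < mu / r ^+ 2 by rewrite divr_gt0// exprn_gt0.
rewrite normrM (gtr0_norm r2) normrM.
have h1 : `|q - r| <= t by rewrite ler_norml; apply/andP; split; lra.
have q0 : 0 <= q by exact: enorm_ge0.
have h2 : `|q + r| <= 3 * r by rewrite ger0_norm; lra.
apply: (@le_lt_trans _ _ (mu / r ^+ 2 * (t * (3 * r)))).
  by rewrite ler_pM2l// ler_pM.
rewrite [ltLHS](_ : _ = 3 * t * mu / r); last by field; rewrite gt_eqF.
rewrite ltr_pdivrMr//.
move: xd; rewrite ltr_pdivlMr; last by rewrite mulr_gt0.
have : 0 <= t * mu by rewrite mulr_ge0// ltW.
lra.
Qed.

(* The next Gaussian is taken at a scale so small that wherever it exceeds e' the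
   previous sum is still within e' of K theta: so the + 1 does not accumulate. *)
Lemma barrier_exists (K : nat) (dl e' : R) : 0 < dl -> 0 < e' ->
  exists (G : N.-tuple R -> R) (eh : R), [/\ measurable_fun setT G, 0 < eh,
   (forall x, 0 <= G x <= K%:R * theta + 1 + K%:R * e') /\
   (forall x, dl <= enorm (vsub x y0) -> G x <= K%:R * e'),
   (forall tau, 0 < tau -> exists2 t, 0 < t &
      forall x, enorm (vsub x y0) < t -> `|G x - K%:R * theta| <= tau) &
   (forall n x rho, D x -> 0 <= rho <= eh -> submean G n x rho)].
Proof.
move=> dl0 e'0; elim: K => [|K [G [eh [mG eh0 [Gb Gfar] Gnear Gsub]]]].
  exists (cst 0), 1; split => //.
  - by split => [x|x _]; rewrite /cst !mul0r ?add0r ?addr0 ?lexx ?ler01.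
  - by move=> tau tau0; exists 1 => // x _; rewrite /cst mul0r subrr normr0 ltW.
  - by move=> n x rho _ _; rewrite /submean/= integral_ge0// => t _; rewrite lee_fin.
have [t1 t10 Gt1] := Gnear _ e'0.
(* The new Gaussian must be small beyond both radii: beyond t1 for the global bound, beyond dl for
   the bound away from y0. *)
have m0 : 0 < Num.min t1 dl by rewrite lt_min t10.
have [r rr rfar] := scaled_far e'0 m0.
have /andP[r_gt0 _] := rr.
have th0 : 0 < theta by exact: expR_gt0.
have K1 : K.+1%:R = K%:R + 1 :> R by rewrite natr1.
exists (fun x => G x + scaled r x).
(* The admissible step length shrinks with each new scale but stays positive for fixed K, which is
   all the threshold on eps needs. *)
exists (Num.min eh (Num.min 1 (r ^+ 2 / (2 * mu)))); split.
- by apply: measurable_funD => //; exact: measurable_gauss.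
- by rewrite !lt_min eh0 ltr01 divr_gt0 ?exprn_gt0// mulr_gt0.
- split => x.
    have /andP[G0 G1] := Gb x; have s0 := scaled_ge0 r x; have s1 := scaled_le1 x r_gt0.
    rewrite addr_ge0//= K1 !mulrDl !mul1r.
    have [xt|/rfar sx] := ltP (enorm (vsub x y0)) (Num.min t1 dl); last by lra.
    have : enorm (vsub x y0) < t1 by rewrite (lt_le_trans xt)// ge_min lexx.
    have Ke : 0 <= K%:R * e' by rewrite mulr_ge0// ltW.
    by move=> /Gt1; rewrite ler_norml => /andP[_]; lra.
  move=> xdl; rewrite K1 mulrDl mul1r; apply: lerD; first exact: Gfar.
  by apply: rfar; rewrite (le_trans _ xdl)// ge_min lexx orbT.
- move=> tau tau0; have tau2 : 0 < tau / 2 by lra.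
  have [ta ta0 ha] := Gnear _ tau2; have [tb tb0 hb] := scaled_near r_gt0 tau2.
  exists (Num.min ta tb); first by rewrite lt_min ta0.
  move=> x; rewrite lt_min => /andP[/ha h1 /hb h2].
  rewrite K1 mulrDl mul1r.
  rewrite (_ : _ - _ = (G x - K%:R * theta) + (scaled r x - theta)); last by ring.
  by apply: (le_trans (ler_normD _ _)); lra.
move=> n x rho Dx /andP[rho0]; rewrite !le_min => /andP[rhoe /andP[rho1 rhor]].
have h1 : submean G n x rho by apply: Gsub => //; rewrite rho0.
have h2 : submean (scaled r) n x rho by apply: scaled_submean => //; rewrite rho0.
rewrite /submean.
have mst : measurable_fun setT (fun t => vadd x (vscale rho (W n t))).
  by apply: (measurableT_comp (measurable_step x rho)).
under eq_integral do rewrite EFinD.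
rewrite EFinD ge0_integralD//.
- exact: leeD.
- by move=> t _; rewrite lee_fin; case/andP: (Gb (vadd x (vscale rho (W n t)))).
- by apply/measurable_EFinP; exact: measurableT_comp.
- by move=> t _; rewrite lee_fin.
- by apply/measurable_EFinP; apply: measurableT_comp => //; exact: measurable_gauss.
Qed.

End Barrier.

(** * The stopped walk *)

Section BoundedIndicatorIntegrals.
Context {R : realType} {d : measure_display} {T : measurableType d}.
Variable P : probability T R.
Local Open Scope ereal_scope.

Lemma integral_affine_indic (A B : R) (E : set T) : (0 <= A)%R -> (0 <= B)%R ->
  measurable E -> \int[P]_t (A * \1_E t + B)%:E = A%:E * P E + B%:E.
Proof.
move=> A0 B0 mE.
have i0 t : (0 <= \1_E t :> R)%R by rewrite indicE ler0n.
have m1 : measurable_fun setT (fun t => (\1_E t)%:E : \bar R).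
  by apply/measurable_EFinP; exact: measurable_indic.
rewrite -[LHS]/(\int[P]_t (A%:E * (\1_E t)%:E + cst B%:E t)).
rewrite ge0_integralD//; last 2 first.
- by move=> t _; apply: mule_ge0; [rewrite lee_fin|rewrite lee_fin i0].
- exact: measurable_funeM.
have -> : \int[P]_t cst B%:E t = B%:E by exact: integral_prob_cst.
by rewrite ge0_integralZl// integral_indic// setIT.
Qed.

Lemma bigcup_measure_le (F : (set T)^nat) (c : \bar R) :
  (forall n, measurable (F n)) -> nondecreasing_seq F -> (forall n, P (F n) <= c) ->
  P (\bigcup_n F n) <= c.
Proof.
move=> mF ndF Fc; have mU := bigcup_measurable (P := setT) (fun n _ => mF n).
have h := nondecreasing_cvg_mu (mu := P) mF mU ndF.
rewrite -(cvg_lim _ h)//; apply: lime_le; first by apply/cvg_ex; exists (P (\bigcup_n F n)).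
by near=> n; exact: Fc.
Unshelve. all: by end_near. Qed.

End BoundedIndicatorIntegrals.

Section StoppedWalk.
Context {R : realType} {N : nat} {d : measure_display} {T : measurableType d}.
Let V := N.-tuple R.
Variables (P : probability T R) (W : nat -> T -> V).
Hypothesis W_meas : forall n, measurable_fun setT (W n).
Hypothesis W_indep : mutually_independent P W.
Hypothesis W_lt1 : forall n t, enorm (W n t) < 1.
Variables (D : set V) (y0 : V).
Hypothesis y0_bd : eboundary D y0.
Variables (eps : R) (x0 : V).
Hypotheses (eps_gt0 : 0 < eps) (Dx0 : D x0).

Definition walk_radius (x : V) : R := Num.min eps (edist_bd D x).

Definition walk_step (x v : V) : V := vadd x (vscale (walk_radius x) v).

Lemma walk_radius_ge0 x : 0 <= walk_radius x.
Proof. by rewrite le_min (ltW eps_gt0) (edist_bd_ge0 y0_bd). Qed.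

Lemma walk_step_in x v : D x -> enorm v < 1 -> D (walk_step x v).
Proof.
move=> Dx v1; rewrite /walk_step; apply: ball_step_in => //.
by rewrite walk_radius_ge0 ge_min lexx orbT.
Qed.

Lemma measurable_walk_step d' (S : measurableType d') (f g : S -> V) :
  measurable_fun setT f -> measurable_fun setT g ->
  measurable_fun setT (fun s => walk_step (f s) (g s)).
Proof.
move=> mf mg; apply: measurable_vadd => //; apply: measurable_vscale => //.
apply: measurable_minr => //.
by apply: measurableT_comp => //; exact: measurable_edist_bd y0_bd.
Qed.

Lemma measurable_ball_walk (w : nat -> T -> V) n :
  (forall n, measurable_fun setT (w n)) ->
  measurable_fun setT (fun t => ball_walk D eps x0 w t n).
Proof.
move=> mw; elim: n => [|n IH] /=; first exact: measurable_cst.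
exact: measurable_walk_step.
Qed.

Let X n t := ball_walk D eps x0 W t n.

Lemma ball_walk_in n t : D (X n t).
Proof. by elim: n => //= n IH; exact: walk_step_in. Qed.

Variables (m : nat) (lam : R) (a0 : V).

(* State (a, (z, x)): x is the walk, a the reference point (the walk itself
   before time m, then frozen) and z the walk stopped on leaving the
   lam-ball around a. *)
Definition stopped_step (n : nat) (sv : (V * (V * V)) * V) : V * (V * V) :=
  let: ((a, (z, x)), v) := sv in
  if (n < m)%N then (walk_step x v, (walk_step x v, walk_step x v))
  else (a, (if enorm (vsub z a) < lam then walk_step z v else z, walk_step x v)).

Let mst n : measurable_fun setT (stopped_step n).
Proof.
rewrite (_ : stopped_step n = fun q =>
  if (n < m)%N
  then (walk_step q.1.2.2 q.2, (walk_step q.1.2.2 q.2, walk_step q.1.2.2 q.2))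
  else (q.1.1, (if enorm (vsub q.1.2.1 q.1.1) < lam then walk_step q.1.2.1 q.2
                else q.1.2.1, walk_step q.1.2.2 q.2))); last first.
  by apply/funext => -[[a [z x]] v].
have ma : measurable_fun setT (fun q : (V * (V * V)) * V => q.1.1).
  exact: (measurableT_comp (f := fst) _ measurable_fst).
have m12 : measurable_fun setT (fun q : (V * (V * V)) * V => q.1.2).
  exact: (measurableT_comp (f := snd) _ measurable_fst).
have mz : measurable_fun setT (fun q : (V * (V * V)) * V => q.1.2.1).
  exact: (measurableT_comp (f := fst) _ m12).
have mx : measurable_fun setT (fun q : (V * (V * V)) * V => q.1.2.2).
  exact: (measurableT_comp (f := snd) _ m12).
have mxv : measurable_fun setT (fun q : (V * (V * V)) * V => walk_step q.1.2.2 q.2).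
  exact: measurable_walk_step.
case: ltnP => _; first by do 2 apply: measurable_fun_pair => //.
apply: measurable_fun_pair => //; apply: measurable_fun_pair => //.
apply: measurable_fun_ifT => //; last exact: measurable_walk_step.
apply: measurable_fun_ltr => //.
by apply: measurable_enorm; exact: measurable_vsub.
Qed.

(** With m = 0 the reference is the constant a0, taken to be y0 in the exit estimate. With a0 = x0
    it follows the walk and freezes at X_m, as the maximal inequality requires. *)
Definition stopped_walk n t := chain W stopped_step (a0, (x0, x0)) n t.
Let A n t := (stopped_walk n t).1.
Let Z n t := (stopped_walk n t).2.1.

Lemma measurable_stopped_walk n : measurable_fun setT (stopped_walk n).
Proof. exact: measurable_chain. Qed.

Lemma stopped_walkS n t :
  stopped_walk n.+1 t = stopped_step n (stopped_walk n t, W n t).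
Proof. by []. Qed.

Lemma stopped_walk_walk n t : (stopped_walk n t).2.2 = X n t.
Proof.
elim: n => // n IH; rewrite stopped_walkS /=; move: IH.
by case: (stopped_walk n t) => [a [z x]] /= ->; case: ifP.
Qed.

Lemma stopped_walk_in n t : D (Z n t).
Proof.
elim: n => // n; rewrite /Z stopped_walkS; have := ball_walk_in n t.
rewrite -stopped_walk_walk; case: (stopped_walk n t) => [a [z x]] /= Dx Dz.
case: ifP => _ /=; first exact: walk_step_in.
by case: ifP => // _; exact: walk_step_in.
Qed.

Lemma stopped_walk_before n t : a0 = x0 -> (n <= m)%N ->
  A n t = X n t /\ Z n t = X n t.
Proof.
move=> a0x0; case: n => [//|n] nm.
rewrite /A /Z stopped_walkS; have := stopped_walk_walk n t.
by case: (stopped_walk n t) => [a [z x]] /= ->; rewrite nm.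
Qed.

Lemma stopped_walk_ref n t : (m <= n)%N -> A n.+1 t = A n t.
Proof.
rewrite /A stopped_walkS leqNgt => /negbTE.
by case: (stopped_walk n t) => [a [z x]] /= ->.
Qed.

Lemma stopped_walk_refE n t : (m <= n)%N -> A n t = A m t.
Proof.
elim: n => [|n IH]; first by rewrite leqn0 => /eqP ->.
by rewrite leq_eqVlt => /orP[/eqP ->//|mn]; rewrite stopped_walk_ref// IH.
Qed.

Lemma stopped_walk_moving n t : ~~ (enorm (vsub (Z n t) (A n t)) < lam) \/ Z n t = X n t.
Proof.
elim: n => [|n IH]; first by right.
rewrite -stopped_walk_walk /Z /A stopped_walkS.
move: IH; rewrite -stopped_walk_walk /Z /A; case: (stopped_walk n t) => [a [z x]] /= IH.
case: ifP => _ /=; first by right.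
by case: ifP IH => [_ [//|->]|+ _]; [right|move=> /negbT; left].
Qed.

Lemma stopped_walk_frozen n t : (m <= n)%N -> lam <= enorm (vsub (Z n t) (A n t)) ->
  Z n.+1 t = Z n t.
Proof.
rewrite /Z /A stopped_walkS; case: (stopped_walk n t) => [a [z x]] /=.
by rewrite leqNgt => /negbTE -> /=; rewrite leNgt => /negbTE ->.
Qed.

(** As z is frozen after leaving the ball, for n >= m this condition at the single time n records
    whether the walk left the ball at any time from m to n. *)
Definition exited n : set T := [set t | lam <= enorm (vsub (Z n t) (A n t))].

Lemma measurable_exited n : measurable (exited n).
Proof.
have ms := measurable_stopped_walk n.
have m2 : measurable_fun setT (fun t => (stopped_walk n t).2).
  exact: (measurableT_comp (f := snd) _ ms).
apply: measurable_superlevel; apply: measurable_enorm; apply: measurable_vsub.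
  exact: (measurableT_comp (f := fst) _ m2).
exact: (measurableT_comp (f := fst) _ ms).
Qed.

Lemma exited_nondecreasing n : (m <= n)%N -> exited n `<=` exited n.+1.
Proof.
by move=> mn t ex; rewrite /exited/= stopped_walk_frozen// stopped_walk_ref.
Qed.

(** Either z has already stopped outside the ball or it still equals the walk, so every excursion of
    the unstopped walk is caught. *)
Lemma exitedE n t : (m <= n)%N -> lam <= enorm (vsub (X n t) (A m t)) -> exited n t.
Proof.
move=> mn; rewrite -(stopped_walk_refE t mn).
have [|<-//] := stopped_walk_moving n t.
by rewrite -leNgt.
Qed.

Local Open Scope ereal_scope.

Section BarrierEstimate.
Hypothesis m0 : m = 0%N.
Variables (G : V -> R).
Hypotheses (mG : measurable_fun setT G) (G_ge0 : forall x, (0 <= G x)%R).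
Hypothesis G_submean : forall n x rho, D x -> (0 <= rho <= eps)%R -> submean P W G n x rho.

Lemma barrier_le n : (G x0)%:E <= \int[P]_t (G (Z n t))%:E.
Proof.
have -> : (G x0)%:E = \int[P]_t (G (stopped_walk 0 t).2.1)%:E.
  by rewrite /= integral_prob_cst.
apply: (le_integral_chain W_meas W_indep (s0 := (a0, (x0, x0))) mst
  (m := 0%N) (n := n) (f := fun s => G s.2.1)) => //.
  apply: measurableT_comp => //.
  exact: (measurableT_comp (f := fst) _ measurable_snd).
move=> k t _.
have := stopped_walk_in k t; rewrite -/(stopped_walk k t) /Z.
case: (stopped_walk k t) => [a [z x]] /= Dz.
rewrite m0 ltn0 /=; case: (enorm (vsub z a) < lam)%R => /=.
  by apply: G_submean => //; rewrite walk_radius_ge0 ge_min lexx.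
by rewrite integral_prob_cst.
Qed.

(** The stopped value of G is at most b after exit and a + b otherwise, while its mean is at least
    G(x0). A large G(x0) therefore makes exit unlikely. *)
Lemma exited_le (a b : R) n : (0 <= a)%R -> (0 <= b)%R ->
  (forall x, (G x <= a + b)%R) -> (forall x, (lam <= enorm (vsub x a0) -> G x <= b)%R) ->
  (G x0)%:E <= a%:E * P (~` exited n) + b%:E.
Proof.
move=> a_ge0 b_ge0 Gab Gb; apply: (le_trans (barrier_le n)).
rewrite -integral_affine_indic//; last exact: measurableC (measurable_exited n).
apply: ge0_le_integral => //.
- by move=> t _; rewrite lee_fin.
- apply/measurable_EFinP; apply: measurableT_comp => //.
  apply: (measurableT_comp (f := fst) _ _) => //.
  exact: (measurableT_comp (f := snd) _ (measurable_stopped_walk n)).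
- apply/measurable_EFinP; apply: measurable_funD => //; apply: measurable_funM => //.
  by apply: measurable_indic; exact: measurableC (measurable_exited n).
move=> t _; rewrite lee_fin indicE.
case: (boolP (t \in _)) => [_|]; first by rewrite mulr1.
rewrite notin_setE/= => /contrapT ex; rewrite mulr0 add0r; apply: Gb.
have m0n : (m <= n)%N by rewrite m0.
by move: ex; rewrite /exited/= stopped_walk_refE// m0.
Qed.

End BarrierEstimate.

Section SquareEstimate.
Hypothesis a0x0 : a0 = x0.
Hypothesis W_sym : forall n (B : set (N.-tuple R)), measurable B ->
  P (W n @^-1` (@vopp R N @^-1` B)) = P (W n @^-1` B).
Variable M : R.
Hypothesis D_bound : forall x, D x -> (enorm x <= M)%R.

Definition energy n := \int[P]_t (enorm (X n t) ^+ 2)%:E.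

(** Until exit z = x and this is 2 a.(x - a), affine in x and hence preserved on average; after exit
    only |x|^2 varies, and its mean cannot decrease. At time m it vanishes. *)
Let Phi (s : V * (V * V)) : R :=
  (enorm s.2.2 ^+ 2 - enorm s.1 ^+ 2 - enorm (vsub s.2.1 s.1) ^+ 2)%R.
(** On D one has |a|^2 <= M^2 and |z - a|^2 <= 4 M^2, so C + [Phi] is nonnegative there and the
    truncation at 0 in [f] changes nothing along the chain. *)
Let C : R := (10 * M ^+ 2)%R.
Let f s : R := Num.max 0%R (C + Phi s)%R.

Let stopped_ref_in n t : (m <= n)%N -> D (A n t).
Proof.
move=> mn; rewrite stopped_walk_refE//.
have [-> _] := stopped_walk_before t a0x0 (leqnn m); exact: ball_walk_in.
Qed.

Let stopped_x_in n t : D (stopped_walk n t).2.2.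
Proof. by rewrite stopped_walk_walk; exact: ball_walk_in. Qed.

Let fE (s : V * (V * V)) : D s.1 -> D s.2.1 -> D s.2.2 -> f s = (C + Phi s)%R.
Proof.
move=> Da Dz Dx; apply/max_idPr; rewrite /Phi.
have ha := D_bound Da; have hz := D_bound Dz; have hx := D_bound Dx.
have := enorm_vadd_le s.2.1 (vopp s.1); rewrite enorm_vopp.
rewrite (_ : vadd _ (vopp _) = vsub s.2.1 s.1); last first.
  by apply: eq_from_tnth => i; rewrite !tnthE; ring.
have := enorm_ge0 (vsub s.2.1 s.1); have := enorm_ge0 s.1; have := enorm_ge0 s.2.1.
set q1 := enorm s.1 in ha *; set q2 := enorm s.2.1 in hz *; set q3 := enorm (vsub _ _).
move=> h2 h1 h3 h.
have a1 : (q1 ^+ 2 <= M ^+ 2)%R by rewrite ler_pXn2r ?nnegrE//; lra.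
have a3 : (q3 ^+ 2 <= (2 * M) ^+ 2)%R by rewrite ler_pXn2r ?nnegrE//; lra.
have := sqr_ge0 (enorm s.2.2); have := sqr_ge0 M.
rewrite /C exprMn in a3 *; lra.
Qed.

Let mf : measurable_fun setT f.
Proof.
have ma : measurable_fun setT (fun s : V * (V * V) => s.1) by exact: measurable_fst.
have mz : measurable_fun setT (fun s : V * (V * V) => s.2.1).
  exact: (measurableT_comp (f := fst) _ measurable_snd).
have mx : measurable_fun setT (fun s : V * (V * V) => s.2.2).
  exact: (measurableT_comp (f := snd) _ measurable_snd).
apply: measurable_maxr => //; apply: measurable_funD => //.
apply: measurable_funB; last first.
  by apply: measurable_funX; apply: measurable_enorm; exact: measurable_vsub.
by apply: measurable_funB; apply: measurable_funX; exact: measurable_enorm.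
Qed.

(** Kolmogorov's maximal inequality: since the mean of [Phi] does not decrease from 0, the energy
    gained since time m dominates the mean of |Z_n - X_m|^2, which is at least lam^2 on
    [exited n]. *)
Lemma energy_gap n : (m <= n)%N -> (0 <= lam)%R ->
  (lam ^+ 2)%:E * P (exited n) + energy m <= energy n.
Proof.
move=> mn lam0.
have f0 s : (0 <= f s)%R by rewrite le_max lexx.
have C0 : (0 <= C)%R by rewrite mulr_ge0// sqr_ge0.
have fC t : f (stopped_walk m t) = C.
  have [Am Zm] := stopped_walk_before t a0x0 (leqnn m).
  rewrite fE; [|exact: stopped_ref_in|exact: stopped_walk_in|exact: stopped_x_in].
  rewrite /Phi stopped_walk_walk -/(A m t) -/(Z m t) Am Zm enorm_vsubxx.
  by rewrite expr0n/= subrr subr0 addr0.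
have sub : \int[P]_t (f (stopped_walk m t))%:E <= \int[P]_t (f (stopped_walk n t))%:E.
  apply: (le_integral_chain W_meas W_indep (s0 := (a0, (x0, x0))) mst) => // k t mk.
  apply: (le_integral_midpoint (W_meas k) (W_lt1 k) (W_sym k)
     (h := fun v => f (stopped_step k (stopped_walk k t, v)))) => //.
    by apply: measurableT_comp => //; apply: measurableT_comp.
  move=> v v1; rewrite -/(stopped_walk k t).
  have v1' : (enorm (vopp v) < 1)%R by rewrite enorm_vopp.
  have Da := stopped_ref_in t mk; have Dz := stopped_walk_in k t.
  have Dx := ball_walk_in k t; rewrite -stopped_walk_walk in Dx.
  have mov := stopped_walk_moving k t; rewrite -stopped_walk_walk in mov.
  move: Da Dz Dx mov; rewrite /A /Z; case: (stopped_walk k t) => [a [z x]] /= Da Dz Dx mov.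
  rewrite ltnNge mk /=.
  case: ifPn => za.
    have {mov} zx : z = x by case: mov => //; rewrite za.
    rewrite zx in Dz za *; rewrite !fE//=; try exact: walk_step_in.
    rewrite /Phi/= !sqr_enorm /walk_step vadd_vscale_vopp !vsub_vadd !vdotE.
    rewrite (vdotC v x) (vdotC a x) (vdotC v a).
    by rewrite le_eqVlt; apply/orP; left; apply/eqP; ring.
  rewrite !fE//=; try exact: walk_step_in.
  (* After exit, averaging over v and -v raises |x|^2 by exactly rho^2 |v|^2. *)
  rewrite /Phi/= !sqr_enorm /walk_step vadd_vscale_vopp !vdotE (vdotC v x).
  have := mulr_ge0 (sqr_ge0 (walk_radius x)) (vdot_ge0 v); lra.
have m2 : measurable_fun setT (fun t => (stopped_walk n t).2).
  exact: (measurableT_comp (f := snd) _ (measurable_stopped_walk n)).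
have mA : measurable_fun setT (A n).
  exact: (measurableT_comp (f := fst) _ (measurable_stopped_walk n)).
have mZ : measurable_fun setT (Z n) by exact: (measurableT_comp (f := fst) _ m2).
have mX : measurable_fun setT (X n) by exact: measurable_ball_walk.
pose g t := (enorm (vsub (Z n t) (A n t)) ^+ 2)%:E.
have mg : measurable_fun setT g.
  apply/measurable_EFinP; apply: measurable_funX.
  by apply: measurable_enorm; exact: measurable_vsub.
have mfn : measurable_fun setT (fun t => (f (stopped_walk n t))%:E).
  by apply/measurable_EFinP; apply: measurableT_comp => //; exact: measurable_stopped_walk.
have mAn : measurable_fun setT (fun t => (enorm (A n t) ^+ 2)%:E).
  by apply/measurable_EFinP; apply: measurable_funX; exact: measurable_enorm.
have mXn : measurable_fun setT (fun t => (enorm (X n t) ^+ 2)%:E).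
  by apply/measurable_EFinP; apply: measurable_funX; exact: measurable_enorm.
have intC : \int[P]_t cst C%:E t = C%:E by exact: integral_prob_cst.
(* The definition of [Phi] is rearranged into sums of nonnegative terms, so that no extended-real
   integrals are subtracted. *)
have total : \int[P]_t (f (stopped_walk n t))%:E + (\int[P]_t g t + energy m) =
    C%:E + energy n.
  have -> : energy m = \int[P]_t (enorm (A n t) ^+ 2)%:E.
    apply: eq_integral => t _; rewrite stopped_walk_refE//.
    by have [-> _] := stopped_walk_before t a0x0 (leqnn m).
  rewrite -intC -!ge0_integralD//; try by move=> t _; rewrite ?adde_ge0// ?lee_fin ?sqr_ge0.
    apply: eq_integral => t _; rewrite fE; [|exact: stopped_ref_in|exact: stopped_walk_in|exact: stopped_x_in].
    rewrite /g -!EFinD /Phi stopped_walk_walk; congr EFin; rewrite /A /Z; ring.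
  exact: emeasurable_funD.
have exg : (lam ^+ 2)%:E * P (exited n) <= \int[P]_t g t.
  have mE := measurable_exited n.
  have := @integral_affine_indic _ _ _ P (lam ^+ 2) 0 (exited n) (sqr_ge0 _) (lexx _) mE.
  rewrite adde0 => <-; apply: ge0_le_integral => //.
  - by move=> t _; rewrite lee_fin addr0 mulr_ge0 ?sqr_ge0// indicE ler0n.
  - by apply/measurable_EFinP; apply: measurable_funD => //; apply: measurable_funM.
  move=> t _; rewrite lee_fin addr0 indicE.
  case: (boolP (t \in _)) => [|_]; last by rewrite mulr0 sqr_ge0.
  by rewrite inE /exited/= mulr1 => h; rewrite ler_pXn2r ?nnegrE ?enorm_ge0.
have fmC : \int[P]_t (f (stopped_walk m t))%:E = C%:E.
  by rewrite -intC; apply: eq_integral => t _; rewrite fC.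
rewrite fmC in sub.
rewrite -(@leeD2lE _ C%:E)//; rewrite -total.
by apply: leeD => //; exact: leeD.
Qed.

End SquareEstimate.

End StoppedWalk.

(** * Convergence of the walk *)

Section EuclideanConvergence.
Context {R : realType} {N : nat}.
Implicit Types u : nat -> N.-tuple R.

Lemma econverges_cauchy u :
  (forall e, 0 < e -> exists m, forall n, (m <= n)%N -> enorm (vsub (u n) (u m)) < e) ->
  exists L, econverges u L.
Proof.
move=> uC.
have coord i : cvgn (fun n => tnth (u n) i : R).
  apply: cauchy_cvg; apply: cauchy_exP => e e0; have [m hm] := uC e e0.
  exists (tnth (u m) i); exists m => // n /= /hm; apply: le_lt_trans.
  by rewrite /ball/= distrC -tnth_vsub normr_tnth_le_enorm.
pose L : N.-tuple R := [tuple limn (fun n => tnth (u n) i : R) | i < N].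
exists L => e e0; have e'0 : 0 < e / N.+1%:R by rewrite divr_gt0.
have /choice[f hf] : forall i : 'I_N, exists m, forall n, (m <= n)%N ->
    `|tnth (u n) i - tnth L i| < e / N.+1%:R.
  move=> i; have /cvgrPdist_lt/(_ _ e'0)[m _ hm] := coord i.
  by exists m => n mn; rewrite distrC tnth_mktuple; exact: hm.
exists (\max_(i < N) f i) => n fn; apply: le_lt_trans (enorm_le_sum _) _.
apply: (@le_lt_trans _ _ (\sum_(i < N) e / N.+1%:R)).
  apply: ler_sum => i _; rewrite tnthE ltW// hf//.
  by apply: leq_trans fn; exact: leq_bigmax.
rewrite sumr_const card_ord -(mulr_natr _ N) mulrAC ltr_pdivrMr//.
by rewrite ltr_pM2l// ltr_nat.
Qed.

Lemma invS_lt (e : R) : 0 < e -> exists k : nat, k.+1%:R^-1 < e.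
Proof.
move=> e0; exists (Num.bound e^-1); rewrite -[ltRHS]invrK ltf_pV2 ?posrE ?invr_gt0//.
have /archi_boundP h : 0 <= e^-1 by rewrite invr_ge0 ltW.
by apply: (lt_trans h); rewrite ltr_nat.
Qed.

(** This serves measurability: the quantifier over limits becomes a Cauchy condition with countable
    quantifiers, and membership of the limit in the open ball becomes an eventual closed bound with
    margin 1 / (k + 1). *)
Lemma econverges_in_eballP u y r :
  (exists L, econverges u L /\ eball y r L) <->
  (forall k : nat, exists m, forall n, (m <= n)%N -> enorm (vsub (u n) (u m)) < k.+1%:R^-1) /\
  (exists k m : nat, forall n, (m <= n)%N -> enorm (vsub (u n) y) <= r - k.+1%:R^-1).
Proof.
split => [[L [uL]]|[uC [k [m ur]]]].
  rewrite /eball/= => Lr; split => [k|].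
    have /uL[m hm] : 0 < k.+1%:R^-1 / 2 :> R by rewrite divr_gt0.
    exists m => n /hm h1; have h2 := hm m (leqnn m).
    have := enorm_vsub_trans L (u n) (u m); rewrite (enorm_vsubC L (u _)).
    by move: h1 h2; set q := k.+1%:R^-1 => h1 h2; lra.
  have d0 : 0 < (r - enorm (vsub L y)) / 2 by lra.
  have [k hk] := invS_lt d0; have [m hm] := uL _ d0.
  exists k, m => n /hm h; have := enorm_vsub_trans L (u n) y.
  by move: hk; set q := k.+1%:R^-1 => hk; lra.
have [e e0|L uL] := @econverges_cauchy u.
  have [k' hk] := invS_lt e0; have [m' hm] := uC k'.
  by exists m' => n /hm /lt_trans; apply.
exists L; split => //; rewrite /eball/=.
have k0 : 0 < k.+1%:R^-1 :> R by rewrite invr_gt0.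
have [n0 hn] := uL _ k0.
have h1 := hn _ (leq_maxl n0 m); have h2 := ur _ (leq_maxr n0 m).
have := enorm_vsub_trans (u (maxn n0 m)) L y; rewrite (enorm_vsubC L (u _)).
by move: h1 h2; set q := k.+1%:R^-1 => h1 h2; lra.
Qed.

Lemma measurable_econverges_in_eball d (T : measurableType d)
    (X : nat -> T -> N.-tuple R) y r :
  (forall n, measurable_fun setT (X n)) ->
  measurable [set t | exists L, econverges (fun n => X n t) L /\ eball y r L].
Proof.
move=> mX.
have mdist (f g : T -> N.-tuple R) : measurable_fun setT f -> measurable_fun setT g ->
    measurable_fun setT (fun t => enorm (vsub (f t) (g t))).
  by move=> mf mg; apply: measurable_enorm; exact: measurable_vsub.
rewrite (_ : [set _ | _] =
  (\bigcap_(k : nat) \bigcup_m \bigcap_(n in [set n | (m <= n)%N])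
     [set t | enorm (vsub (X n t) (X m t)) < k.+1%:R^-1]) `&`
  (\bigcup_k \bigcup_m \bigcap_(n in [set n | (m <= n)%N])
     [set t | enorm (vsub (X n t) y) <= r - k.+1%:R^-1])).
  apply: measurableI.
    apply: bigcap_measurable => // k _; apply: bigcup_measurable => m _.
    apply: bigcap_measurable; first by exists m => /=.
    by move=> n _; apply: measurable_strict_sublevel; exact: mdist.
  apply: bigcup_measurable => k _; apply: bigcup_measurable => m _.
  apply: bigcap_measurable; first by exists m => /=.
  by move=> n _; apply: measurable_sublevel; exact: (mdist _ (cst y)).
apply/seteqP; split => t.
  move=> /econverges_in_eballP[uC [k [m ur]]]; split.
    by move=> k' _; have [m' hm] := uC k'; exists m' => // n /= /hm.
  by exists k => //; exists m => // n /= /ur.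
move=> [uC [k _ [m _ ur]]]; apply/econverges_in_eballP; split.
  by move=> k'; have [m' _ hm] := uC k' I; exists m' => n mn; exact: hm.
by exists k, m => n mn; exact: ur.
Qed.

End EuclideanConvergence.

(** * Almost sure convergence from bounded energy *)

Section WalkConvergence.
Context {R : realType} {N : nat} {d : measure_display} {T : measurableType d}.
Variables (P : probability T R) (W : nat -> T -> N.-tuple R).
Hypothesis W_meas : forall n, measurable_fun setT (W n).
Hypothesis W_indep : mutually_independent P W.
Hypothesis W_lt1 : forall n t, enorm (W n t) < 1.
Hypothesis W_sym : forall n (A : set (N.-tuple R)), measurable A ->
  P (W n @^-1` (@vopp R N @^-1` A)) = P (W n @^-1` A).
Variables (D : set (N.-tuple R)) (y0 : N.-tuple R).
Hypothesis y0_bd : eboundary D y0.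
Variable M : R.
Hypothesis D_bound : forall x, D x -> enorm x <= M.
Variables (eps : R) (x0 : N.-tuple R).
Hypotheses (eps_gt0 : 0 < eps) (Dx0 : D x0).
Local Open Scope ereal_scope.

Let X n t := ball_walk D eps x0 W t n.

Let mX n : measurable_fun setT (X n).
Proof. by apply: measurable_ball_walk => //; exact: y0_bd. Qed.

(** Failure of the Cauchy property at scale lam, with each time m as its own reference so that
    [energy_gap] applies from m. *)
Definition oscillates (lam : R) : set T :=
  [set t | forall m, exists2 n, (m <= n)%N & (lam <= enorm (vsub (X n t) (X m t)))%R].

Lemma measurable_oscillates lam : measurable (oscillates lam).
Proof.
rewrite (_ : oscillates lam = \bigcap_m \bigcup_(n in [set n | (m <= n)%N])
   [set t | (lam <= enorm (vsub (X n t) (X m t)))%R]).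
  apply: bigcap_measurable => // m _; apply: bigcup_measurable => n _.
  by apply: measurable_superlevel; apply: measurable_enorm; exact: measurable_vsub.
apply/seteqP; split => t ot m => [_|].
  by have [n mn h] := ot m; exists n.
by have [n mn h] := ot m I; exists n.
Qed.

Lemma energy_le n : energy P W D eps x0 n <= (M ^+ 2)%:E.
Proof.
have := @integral_affine_indic _ _ _ P 0 (M ^+ 2) setT (lexx _) (sqr_ge0 _) measurableT.
rewrite mul0e add0e => <-; apply: ge0_le_integral => //.
- by move=> t _; rewrite lee_fin sqr_ge0.
- by apply/measurable_EFinP; apply: measurable_funX; exact: measurable_enorm (mX n).
- by apply/measurable_EFinP; apply: measurable_funD => //; apply: measurable_funM.
move=> t _; rewrite lee_fin mul0r add0r.
have h : (enorm (X n t) <= M)%R.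
  by apply: D_bound; apply: (ball_walk_in W_lt1 y0_bd).
by rewrite ler_pXn2r ?nnegrE ?enorm_ge0// (le_trans _ h)// enorm_ge0.
Qed.

Lemma oscillates_null lam : (0 < lam)%R -> P (oscillates lam) = 0.
Proof.
move=> lam0; apply/eqP; rewrite eq_le measure_ge0 andbT.
apply/lee_addgt0Pr => e e0; rewrite add0e.
pose v n := fine (energy P W D eps x0 n).
have en_ge0 n : 0 <= energy P W D eps x0 n.
  by apply: integral_ge0 => t _; rewrite lee_fin sqr_ge0.
have vE n : energy P W D eps x0 n = (v n)%:E.
  by rewrite fineK// ge0_fin_numE// (le_lt_trans (energy_le n))// ltry.
have supv : has_sup (range v).
  split; first by exists (v 0%N), 0%N.
  by exists (M ^+ 2)%R => _ [n _ <-]; rewrite -lee_fin -vE energy_le.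
have el0 : (0 < e * lam ^+ 2)%R by rewrite mulr_gt0// exprn_gt0.
(* From this m on the energy can rise by less than e lam^2, so the walk leaves the lam-ball around
   X_m with probability at most e; oscillation implies such an exit. *)
have [_ [m _ <-] vm] := sup_adherent el0 supv.
pose ex n := exited W D eps x0 m lam x0 (m + n)%N.
have mex n : measurable (ex n) by exact: measurable_exited y0_bd _ _ _ _ _ _.
have exn n : P (ex n) <= e%:E.
  have := energy_gap W_meas W_indep W_lt1 y0_bd eps_gt0 Dx0 (erefl x0) W_sym D_bound
    (leq_addr n m) (ltW lam0).
  rewrite !vE -/(ex n) -(fineK (fin_num_measure P _ (mex n))) -EFinM -EFinD !lee_fin.
  have vs : (v (m + n)%N <= sup (range v))%R by apply: ub_le_sup (supv.2) _ _; exists (m + n)%N.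
  move=> h; have l2 : (0 < lam ^+ 2)%R by rewrite exprn_gt0.
  rewrite -(ler_pM2l l2) (mulrC _ e); lra.
have mU : measurable (\bigcup_n ex n) by exact: bigcup_measurable.
apply: (@le_trans _ _ (P (\bigcup_n ex n))).
  apply: le_measure; rewrite ?inE//; first exact: measurable_oscillates.
  move=> t /(_ m)[n mn h]; exists (n - m)%N => //.
  rewrite /ex subnKC//; apply: exitedE => //.
  have [-> _] := stopped_walk_before W D eps lam t (erefl x0) (leqnn m).
  exact: h.
apply: bigcup_measure_le => //; apply/nondecreasing_seqP => n; apply/subsetPset.
by rewrite /ex addnS; apply: exited_nondecreasing; exact: leq_addr.
Qed.

Lemma oscillates_cauchy t : (forall k : nat, ~ oscillates k.+1%:R^-1 t) ->
  exists L, econverges (fun n => X n t) L.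
Proof.
move=> nosc; apply: econverges_cauchy => e e0.
have [k ke] := invS_lt e0.
have /existsNP[m hm] := nosc k.
exists m => n mn; rewrite ltNge; apply/negP => h; apply: hm.
by exists n => //; rewrite (le_trans _ h)// ltW.
Qed.

End WalkConvergence.

(** * Walk-regularity *)

Section Truncation.
Context {R : realType} {N : nat}.

(** Makes the bound |w| < 1 hold for every outcome. The replacement value 0 is fixed by v -> -v, so
    symmetry is kept. *)
Definition trunc (v : N.-tuple R) : N.-tuple R := if enorm v < 1 then v else vzero.

Lemma enorm_vzero : enorm (@vzero R N) = 0.
Proof. by rewrite -(enorm_vsubxx (@vzero R N)) vsubx0. Qed.

Lemma enorm_trunc v : enorm (trunc v) < 1.
Proof. by rewrite /trunc; case: ifP => // _; rewrite enorm_vzero. Qed.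

Lemma trunc_vopp v : trunc (vopp v) = vopp (trunc v).
Proof.
rewrite /trunc enorm_vopp; case: ifP => // _.
by apply: eq_from_tnth => i; rewrite tnthE tnth_mktuple mulr0.
Qed.

Lemma measurable_trunc : measurable_fun setT trunc.
Proof.
apply: measurable_fun_ifT => //.
by apply: measurable_fun_ltr => //; exact: measurable_enorm.
Qed.

Lemma ball_walk_trunc T (D : set (N.-tuple R)) eps x (w : nat -> T -> N.-tuple R) t n :
  (forall n, enorm (w n t) < 1) ->
  ball_walk D eps x (fun n => trunc \o w n) t n = ball_walk D eps x w t n.
Proof. by move=> w1; elim: n => //= n ->; rewrite /trunc w1. Qed.

End Truncation.

Section TruncatedSteps.
Context {R : realType} {N : nat} {d : measure_display} {T : measurableType d}.
Variables (P : probability T R) (w : nat -> T -> N.-tuple R).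
Hypothesis w_meas : forall n, measurable_fun setT (w n).
Hypothesis w_indep : mutually_independent P w.
Hypothesis w_unif : forall n, uniform_unit_ball P (w n).
Local Open Scope ereal_scope.

Let W n := trunc \o w n.

Let mtrunc (A : set (N.-tuple R)) : measurable A -> measurable (trunc @^-1` A).
Proof. by move=> mA; apply: measurable_preimage => //; exact: measurable_trunc. Qed.

Lemma measurable_trunc_step n : measurable_fun setT (W n).
Proof. by apply: measurableT_comp => //; exact: measurable_trunc. Qed.

Lemma trunc_indep : mutually_independent P W.
Proof.
move=> F A uF mA.
exact: (w_indep (A := fun i => trunc @^-1` A i) uF (fun i => mtrunc (mA i))).
Qed.

Lemma trunc_sym n (A : set (N.-tuple R)) : measurable A ->
  P (W n @^-1` (@vopp R N @^-1` A)) = P (W n @^-1` A).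
Proof.
move=> mA; rewrite -[RHS](uniform_unit_ball_sym (w_unif n) (mtrunc mA)).
by congr (P _); apply/seteqP; split => t /=; rewrite trunc_vopp.
Qed.

Lemma trunc_spread n (u : N.-tuple R) :
  ((@box_side R N / 2) ^+ N)%:E <=
  P (W n @^-1` [set v | ((@box_side R N * enorm u) ^+ 2 <= vdot u v ^+ 2)%R]).
Proof.
apply: (le_trans (uniform_unit_ball_spread (w_meas n) (w_unif n) u)).
have mA := measurable_vdot_sqr_ge u ((@box_side R N * enorm u) ^+ 2)%R.
apply: le_measure; rewrite ?inE.
- apply: (measurable_preimage (w_meas n)); apply: measurableI => //.
  exact: measurable_eball.
- by apply: measurable_preimage => //; exact: measurable_trunc_step.
by move=> t [/= hu]; rewrite unit_ballE => w1; rewrite /W /preimage/= /trunc w1.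
Qed.

Lemma unit_ball_steps_null :
  P (\bigcup_n (w n @^-1` ~` eball (@vzero R N) 1)) = 0.
Proof.
have mE n : measurable (w n @^-1` ~` eball (@vzero R N) 1).
  by apply: measurable_preimage => //; apply: measurableC; exact: measurable_eball.
have neg : P.-negligible (\bigcup_n (w n @^-1` ~` eball (@vzero R N) 1)).
  apply: negligible_bigcup => n; apply/negligibleP => //.
  exact: uniform_unit_ball_inside (w_unif n).
by move/negligibleP: neg; apply; exact: bigcup_measurable.
Qed.

End TruncatedSteps.

Lemma measure_null_bigcup_le {R : realType} d (T : measurableType d)
    (P : probability T R) (A B E S : set T) (eta : R) :
  measurable A -> measurable B -> measurable E -> measurable S ->
  P A = 0%E -> P B = 0%E -> (P E <= eta%:E)%E -> ~` S `<=` A `|` B `|` E ->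
  ((1 - eta)%:E <= P S)%E.
Proof.
move=> mA mB mE mS A0 B0 Eeta sub.
have : (P (~` S) <= eta%:E)%E.
  apply: (@le_trans _ _ (P (A `|` B `|` E))).
    apply: le_measure => //; rewrite inE; first exact: measurableC.
    by apply: measurableU => //; exact: measurableU.
  apply: (le_trans (measureU2 _ _ _)) => //; first exact: measurableU.
  rewrite -[leRHS]add0e; apply: leeD => //.
  by apply: (le_trans (measureU2 _ _ _)) => //; rewrite [X in (_ + X)%E]B0 [X in (X + _)%E]A0 adde0.
rewrite probability_setC// -(fineK (fin_num_measure P S mS)) -EFinB !lee_fin; lra.
Qed.

Unset Implicit Arguments.
Set Strict Implicit.

Theorem theorem2p19 (R : realType) (N : nat)
  (d : measure_display) (T : measurableType d) (P : probability T R)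
  (w : nat -> T -> N.-tuple R)
  (w_meas : forall n, measurable_fun setT (w n))
  (w_indep : mutually_independent P w)
  (w_unif : forall n, uniform_unit_ball P (w n))
  (D : set (N.-tuple R))
  (D_open : eopen D) (D_bounded : ebounded D) (D_conn : econnected D)
  (y0 : N.-tuple R) (y0_bd : eboundary D y0)
  (ext_cone : exists C : set (N.-tuple R),
                is_finite_cone_at C y0 /\ C `<=` ~` D) :
  walk_regular P w D y0.
Proof.
case: ext_cone => _ [[e [h [a [e1 [h0 [a0 ->]]]]]] CD].
have [kappa [r0 [/andP[kappa0 _] r00 cone]]] := finite_cone_contains_balls y0 e1 h0 a0.
have avoid r x : 0 < r < r0 -> D x ->
    kappa * r <= enorm (vsub x (vadd y0 (vscale r e))).
  by move=> rr Dx; rewrite leNgt; apply/negP => /(cone _ rr)/CD.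
have [M D_bound] := D_bounded.
pose W n := trunc \o w n.
have W_meas n : measurable_fun setT (W n) by exact: measurable_trunc_step.
have W_indep : mutually_independent P W by exact: trunc_indep.
have W_lt1 n t : enorm (W n t) < 1 by exact: enorm_trunc.
have W_sym := @trunc_sym _ _ _ _ _ _ w_unif.
have s0 : 0 < @box_side R N by exact: box_side_gt0.
have p0 : 0 < (@box_side R N / 2) ^+ N by rewrite exprn_gt0// divr_gt0.
have W_spread := trunc_spread w_meas w_unif.
move=> eta delta eta0 delta0.
have lam0 : 0 < delta / 2 by rewrite divr_gt0.
(* These depend only on N and kappa, hence on the aperture of the cone, so K can be fixed before any
   radius. *)
set mu := 4 / ((@box_side R N / 2) ^+ N * @box_side R N ^+ 2 * kappa ^+ 2).
set theta := expR (- mu).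
have theta0 : 0 < theta by exact: expR_gt0.
(* With q the exit probability, comparing G near y0 with its stopped mean gives (K theta + 1) q <= 1
   + 2 K e'. For this e', and K theta eta >= 8, the right side is at most 3/8 of K theta eta, which
   forces q <= eta. *)
pose e' := theta * eta / 8.
have e'0 : 0 < e' by rewrite divr_gt0// mulr_gt0.
have [K hK] : exists K : nat, 8 / eta <= K%:R * theta.
  have /archi_boundP h8 : 0 <= 8 / eta / theta by rewrite !divr_ge0// ltW.
  by exists (Num.bound (8 / eta / theta)); rewrite -ler_pdivrMr// ltW.
have [G [eh [mG eh0 [Gb Gfar] Gnear Gsub]]] :=
  barrier_exists W_meas W_lt1 W_sym p0 s0 W_spread e1 kappa0 r00 avoid K lam0 e'0.
rewrite -/mu -/theta in Gb Gnear.
have Ke0 : 0 <= K%:R * e' by rewrite mulr_ge0// ltW.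
have Kth0 : 0 <= K%:R * theta by rewrite mulr_ge0// ltW.
have KeE : K%:R * e' = K%:R * theta * eta / 8 by rewrite /e'; ring.
have Kt : 8 <= K%:R * theta * eta by rewrite -ler_pdivrMr.
have Kep : 0 < K%:R * e' by rewrite KeE; lra.
have [t t0 near0] := Gnear _ Kep.
exists (Num.min t (delta / 2)), (Num.min eh 2^-1).
split; first by rewrite lt_min t0 lam0 gt_min; apply/orP; right; lra.
split; first by rewrite lt_min eh0 invr_gt0 ltr0n gt_min invf_lt1// ltr1n orbT.
move=> eps x0 /andP[eps0]; rewrite lt_min => /andP[epsh _].
rewrite /eball/= lt_min => /andP[x0t _] Dx0.
have mS : measurable (walk_limit_in D eps x0 w (eball y0 delta)).
  by apply: measurable_econverges_in_eball => n; exact: measurable_ball_walk y0_bd _ _ _ _ w_meas.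
(* Radius delta / 2 rather than delta, so that the limit of a walk that never exits lies strictly
   inside the ball of radius delta. *)
pose ex n := exited W D eps x0 0 (delta / 2) y0 n.
have mex n : measurable (ex n) by exact: measurable_exited y0_bd _ _ _ _ _ _.
have exn n : (P (ex n) <= eta%:E)%E.
  have aK : 0 <= K%:R * theta + 1 by lra.
  have G_ge0 x : 0 <= G x by case/andP: (Gb x).
  have G_le x : G x <= K%:R * theta + 1 + K%:R * e' by case/andP: (Gb x).
  have Gs k x rho : D x -> 0 <= rho <= eps -> submean P W G k x rho.
    by move=> Dx /andP[r1 r2]; apply: Gsub => //; rewrite r1 (le_trans r2)// ltW.
  have := exited_le W_meas W_indep W_lt1 y0_bd eps0 Dx0 (lam := delta / 2) (a0 := y0)
    (erefl 0%N) mG G_ge0 Gs n aK Ke0 G_le Gfar.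
  rewrite probability_setC// -(fineK (fin_num_measure P _ (mex n))) -EFinB -EFinM -EFinD !lee_fin.
  set q := fine _ => hq.
  have := near0 _ x0t; rewrite ler_norml => /andP[Glow _].
  have : (K%:R * theta + 1) * q <= 1 + 2 * (K%:R * e') by lra.
  rewrite KeE => hq2; rewrite leNgt; apply/negP => qeta.
  have : (K%:R * theta + 1) * eta < (K%:R * theta + 1) * q by rewrite ltr_pM2l//; lra.
  lra.
have mU : measurable (\bigcup_n ex n) by exact: bigcup_measurable.
have exU : (P (\bigcup_n ex n) <= eta%:E)%E.
  apply: bigcup_measure_le => //; apply/nondecreasing_seqP => n; apply/subsetPset.
  exact: exited_nondecreasing.
pose osc k := oscillates W D eps x0 (k.+1%:R^-1).
have mosc k : measurable (osc k) by exact: measurable_oscillates y0_bd _ _ _.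
have oscU : P (\bigcup_k osc k) = 0%E.
  have neg : P.-negligible (\bigcup_k osc k).
    apply: negligible_bigcup => k; apply/negligibleP; first exact: mosc.
    by apply: (oscillates_null W_meas W_indep W_lt1 W_sym y0_bd D_bound eps0 Dx0); rewrite invr_gt0.
  by move/negligibleP: neg; apply; exact: bigcup_measurable.
have mout : measurable (\bigcup_n (w n @^-1` ~` eball (@vzero R N) 1)).
  apply: bigcup_measurable => n _; apply: measurable_preimage => //.
  by apply: measurableC; exact: measurable_eball.
apply: (measure_null_bigcup_le mout (bigcup_measurable (P := setT) (fun k _ => mosc k)) mU mS
  (unit_ball_steps_null w_meas w_unif) oscU exU).
(* Off the three exceptional events the truncated and original walks coincide, the walk converges,
   and it has never left the ball of radius delta / 2. *)
move=> om; apply: contra_notP => /not_orP[/not_orP[noout noosc] noex].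
have w1 n : enorm (w n om) < 1.
  by rewrite -unit_ballE; apply: contrapT => wn; apply: noout; exists n.
have [L hL] : exists L, econverges (fun n => ball_walk D eps x0 W om n) L.
  by apply: oscillates_cauchy => k ok; apply: noosc; exists k.
exists L; split.
  move=> r r0'; have [n0 hn] := hL r r0'; exists n0 => n /hn.
  by rewrite ball_walk_trunc.
have near_y0 n : enorm (vsub (ball_walk D eps x0 W om n) y0) < delta / 2.
  rewrite ltNge; apply/negP => hn; apply: noex; exists n => //.
  by apply: exitedE => //; exact: hn.
have [n0 hn] := hL _ lam0.
rewrite /eball/=; have := enorm_vsub_trans (ball_walk D eps x0 W om n0) L y0.
by rewrite (enorm_vsubC L (ball_walk _ _ _ _ _ _)); have := hn _ (leqnn n0); have := near_y0 n0; lra.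
Qed.
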